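(* For any integer $d\ge 3$ and all $u,v\in\mathbb{S}^{d-1}$, $$\Vert\Phi_{\mathbb{S}^{d-1}}(u)-\Phi_{\mathbb{S}^{d-1}}(v)\Vert^2=\pi\cdot d_{\mathbb{S}^{d-1}}(u,v),$$ where $\Phi_{\mathbb{S}^{d-1}}:\mathbb{S}^{d-1}\to\ell^2$ is the generalized cMDS embedding of $\mathbb{S}^{d-1}$ (with geodesic distance $d_{\mathbb{S}^{d-1}}$ and normalized volume measure) and $\Vert\cdot\Vert$ is the $\ell^2$ norm.
   Context: $\mathbb{S}^{d-1}\subset\mathbb{R}^d$ is the unit sphere, $d_{\mathbb{S}^{d-1}}(u,v)=\arccos\langle u,v\rangle$ its geodesic distance, and $\mathrm{nvol}_{\mathbb{S}^{d-1}}$ its normalized (probability) volume measure. For a compact metric space $(X,d_X)$ with a fully supported Borel probability measure $\mu_X$, write $\mathcal X=(X,d_X,\mu_X)$ and define the kernel $$K_{\mathcal X}(x,x')=-\tfrac12\Big(d_X^2(x,x')-\int_X d_X^2(x,v)\,d\mu_X(v)-\int_X d_X^2(u,x')\,d\mu_X(u)+\iint_{X\times X} d_X^2(u,v)\,d\mu_X(u)\,d\mu_X(v)\Big)$$ and the generalized cMDS operator $\mathfrak{K}_{\mathcal X}:L^2(\mu_X)\to L^2(\mu_X)$, $\mathfrak{K}_{\mathcal X}\phi=\int_X K_{\mathcal X}(\cdot,x')\phi(x')\,d\mu_X(x')$, a compact self-adjoint operator. Eigenfunctions for nonzero eigenvalues have continuous representatives, and these are always used. When $\mathfrak K_{\mathcal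 X}$ is trace class, let $\lambda_1\ge\lambda_2\ge\cdots>0$ be its positive eigenvalues (counted with multiplicity) and $\{\phi_i\}$ corresponding $L^2(\mu_X)$-orthonormal eigenfunctions. The generalized cMDS embedding is $\Phi_{\mathcal X}(x)=(\lambda_1^{1/2}\phi_1(x),\lambda_2^{1/2}\phi_2(x),\dots)\in\ell^2$ (padded with zeros if there are finitely many positive eigenvalues). Here this is applied to $\mathcal X=(\mathbb{S}^{d-1},d_{\mathbb{S}^{d-1}},\mathrm{nvol}_{\mathbb{S}^{d-1}})$, for which $\mathfrak K_{\mathcal X}$ is trace class. *)

(* Defs.v *)
From HB Require Import structures.
From mathcomp Require Import all_boot all_order all_algebra.
From mathcomp Require Import all_classical all_reals all_analysis measurable_realfun.
From mathcomp Require Import ring lra.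

Set Implicit Arguments.
Unset Strict Implicit.
Unset Printing Implicit Defensive.

Import Order.TTheory GRing.Theory Num.Theory numFieldNormedType.Exports.

Local Open Scope classical_set_scope.
Local Open Scope ring_scope.

(* Pointedness is only there because the library requires it of measurable
   types. *)
#[short(type="pointedMetricType")]
HB.structure Definition PointedMetric (R : numDomainType) :=
  {X of Metric R X & Pointed X}.

Notation borel X := (g_sigma_algebraType (@open X)).

Section cMDS.
Context {R : realType} {X : pointedMetricType R}.
Variable mu : probability (borel X) R.
Implicit Types (x : X) (lambda : nat -> R) (phi : nat -> X -> R).

Definition cmds_kernel x x' : R :=
  - 2^-1 * (mdist x x' ^+ 2 - \int[mu]_v (mdist x v ^+ 2)
            - \int[mu]_u (mdist u x' ^+ 2)
            + \int[mu]_u \int[mu]_v (mdist u v ^+ 2)).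

Definition cmds_op (f : X -> R) (x : X) : R :=
  \int[mu]_x' (cmds_kernel x x' * f x').

(* Elements of the (real) space L^2(mu) are handled through representatives,
   hence the a.e. conditions. *)
Definition cmds_eigenfunction (l : R) (f : X -> R) : Prop :=
  [/\ (f : borel X -> R) \in Lfun mu 2%:E,
      ~ {ae mu, forall x, f x = 0} &
      {ae mu, forall x, cmds_op f x = l * f x}].

(* lambda enumerates the positive eigenvalues in nonincreasing order; the
   indices i with lambda i = 0 are padding and phi i is then irrelevant.
   By cmds_complete the orthonormal family (phi i) with lambda i = l spans the
   l-eigenspace, so that l occurs with its multiplicity. *)
Record cmds_spectrum lambda phi : Prop := {
  cmds_nonincreasing : forall i j, (i <= j)%N -> lambda j <= lambda i ;
  cmds_ge0 : forall i, 0 <= lambda i ;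
  cmds_eigen : forall i, 0 < lambda i -> cmds_eigenfunction (lambda i) (phi i) ;
  cmds_continuous : forall i, 0 < lambda i -> continuous (phi i) ;
  cmds_orthonormal : forall i j, 0 < lambda i -> 0 < lambda j ->
    \int[mu]_x (phi i x * phi j x) = (i == j)%:R ;
  cmds_complete : forall l f, 0 < l -> cmds_eigenfunction l f ->
    exists (N : nat) (c : nat -> R),
      {ae mu, forall x, f x = \sum_(i < N | lambda i == l) c i * phi i x} }.

Definition cmds_embedding lambda phi (x : X) : nat -> R :=
  fun i => Num.sqrt (lambda i) * phi i x.

End cMDS.

Section euclidean.
Context {R : realType}.

Definition dotp n (x y : n.-tuple R) : R :=
  \sum_(i < n) tnth x i * tnth y i.

Lemma dotpC n (x y : n.-tuple R) : dotp x y = dotp y x.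
Proof. by apply: eq_bigr => i _; rewrite mulrC. Qed.

Lemma dotp_ge0 n (x : n.-tuple R) : 0 <= dotp x x.
Proof. by apply: sumr_ge0 => i _; rewrite -expr2 sqr_ge0. Qed.

Lemma dotp_eq0 n (x : n.-tuple R) : dotp x x = 0 -> forall i, tnth x i = 0.
Proof.
move=> x0 i; apply/eqP; rewrite -sqrf_eq0 expr2; apply/eqP.
by move/psumr_eq0P : x0 => -> // j _; rewrite -expr2 sqr_ge0.
Qed.

Lemma sum_CauchySchwarz n (f g : 'I_n -> R) :
  (\sum_i f i * g i) ^+ 2 <= (\sum_i f i ^+ 2) * (\sum_i g i ^+ 2).
Proof.
have : 0 <= \sum_i \sum_j (f i * g j - f j * g i) ^+ 2.
  by apply: sumr_ge0 => i _; apply: sumr_ge0 => j _; rewrite sqr_ge0.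
rewrite (_ : \sum_i _ = ((\sum_i f i ^+ 2) * (\sum_i g i ^+ 2)
    - (\sum_i f i * g i) ^+ 2) *+ 2); first by rewrite pmulrn_lge0// subr_ge0.
transitivity (\sum_i (f i ^+ 2 * (\sum_j g j ^+ 2)
   + g i ^+ 2 * (\sum_j f j ^+ 2)
   - (f i * g i) * (\sum_j f j * g j) *+ 2)).
  apply: eq_bigr => i _; rewrite 3!mulr_sumr -sumrMnl -sumrN -!big_split/=.
  by apply: eq_bigr => j _; ring.
rewrite !big_split/= -2!mulr_suml sumrN sumrMnl -mulr_suml.
by ring.
Qed.

Lemma dotp_CauchySchwarz n (x y : n.-tuple R) :
  dotp x y ^+ 2 <= dotp x x * dotp y y.
Proof.
apply: le_trans (sum_CauchySchwarz (tnth x) (tnth y)) _.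
by rewrite le_eqVlt; apply/orP; left; apply/eqP; congr (_ * _); apply: eq_bigr.
Qed.

(* The n-dimensional unit sphere, sitting in R^(n+1). *)
Record sphere (n : nat) := Sphere {
  sphere_val :> n.+1.-tuple R ;
  _ : dotp sphere_val sphere_val == 1 }.
Arguments Sphere {n}.

HB.instance Definition _ n := [isSub for @sphere_val n].
HB.instance Definition _ n := [Choice of sphere n by <:].

Definition sphere_dist n (u v : sphere n) : R := acos (dotp u v).

Lemma dotp_sphere n (u : sphere n) : dotp u u = 1.
Proof. by apply/eqP; case: u. Qed.

Lemma dotp_sphere_itv n (u v : sphere n) : -1 <= dotp u v <= 1.
Proof.
have := dotp_CauchySchwarz u v; rewrite !dotp_sphere mulr1.
by rewrite -ler_norml => h; rewrite -(@ler_pXn2r _ 2)// ?nnegrE//; rewrite -normrX ger0_norm ?sqr_ge0// expr1n.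
Qed.

Lemma sphere_dist_ge0 n (u v : sphere n) : 0 <= sphere_dist u v.
Proof. by rewrite acos_ge0// dotp_sphere_itv. Qed.

Lemma sphere_dist_lepi n (u v : sphere n) : sphere_dist u v <= pi.
Proof. by rewrite acos_lepi// dotp_sphere_itv. Qed.

Lemma cos_sphere_dist n (u v : sphere n) : cos (sphere_dist u v) = dotp u v.
Proof. by rewrite acosK// in_itv/= dotp_sphere_itv. Qed.

Lemma sphere_distxx n (u : sphere n) : sphere_dist u u = 0.
Proof. by rewrite /sphere_dist dotp_sphere acos1. Qed.

Lemma sphere_distC n (u v : sphere n) : sphere_dist u v = sphere_dist v u.
Proof. by rewrite /sphere_dist dotpC. Qed.

Lemma sphere_dist_eq0 n (u v : sphere n) : sphere_dist u v = 0 -> u = v.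
Proof.
move=> uv0; have := cos_sphere_dist u v; rewrite uv0 cos0 => uv1.
apply/val_inj/eq_from_tnth => i /=; apply/eqP; rewrite -subr_eq0; apply/eqP.
rewrite -[RHS](@dotp_eq0 _ [tuple tnth u i - tnth v i | i < n.+1] _ i).
  by rewrite tnth_mktuple.
transitivity (dotp u u + dotp v v - dotp u v *+ 2).
  rewrite /dotp -sumrMnl -sumrN -!big_split/=; apply: eq_bigr => j _.
  by rewrite !tnth_mktuple; ring.
by rewrite !dotp_sphere -uv1; ring.
Qed.

Lemma sphere_dist_triangle n (v u w : sphere n) :
  sphere_dist u w <= sphere_dist u v + sphere_dist v w.
Proof.
have [/(le_trans (sphere_dist_lepi u w))//|/ltW uvw] :=
  leP pi (sphere_dist u v + sphere_dist v w).
rewrite leNgt -ltr_cos ?in_itv/= ?sphere_dist_ge0 ?sphere_dist_lepi//; last first.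
  by rewrite addr_ge0 ?sphere_dist_ge0.
rewrite -leNgt cosD !cos_sphere_dist !sin_acos ?dotp_sphere_itv//.
have [a uvE] : {a | dotp u v = a} by exists (dotp u v).
have [b vwE] : {b | dotp v w = b} by exists (dotp v w).
rewrite uvE vwE.
have a1 : 0 <= 1 - a ^+ 2.
  by have := dotp_sphere_itv u v; rewrite uvE => /andP[? ?]; nra.
have b1 : 0 <= 1 - b ^+ 2.
  by have := dotp_sphere_itv v w; rewrite vwE => /andP[? ?]; nra.
rewrite lerBlDr -lerBlDl -sqrtrM//.
apply: le_trans (ler_norm _) _; rewrite -sqrtr_sqr ler_wsqrtr//.
pose f i := tnth u i - a * tnth v i; pose g i := tnth w i - b * tnth v i.
have ff : \sum_i f i ^+ 2 = 1 - a ^+ 2.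
  transitivity (dotp u u - a * dotp u v *+ 2 + a ^+ 2 * dotp v v).
    rewrite /dotp !mulr_sumr -sumrMnl -sumrN -!big_split/=.
    by apply: eq_bigr => j _; rewrite /f; ring.
  by rewrite !dotp_sphere uvE; ring.
have gg : \sum_i g i ^+ 2 = 1 - b ^+ 2.
  transitivity (dotp w w - b * dotp v w *+ 2 + b ^+ 2 * dotp v v).
    rewrite /dotp !mulr_sumr -sumrMnl -sumrN -!big_split/=.
    by apply: eq_bigr => j _; rewrite /g; ring.
  by rewrite !dotp_sphere vwE; ring.
have fg : \sum_i f i * g i = dotp u w - a * b.
  transitivity (dotp u w - b * dotp u v - a * dotp v w + a * b * dotp v v).
    rewrite /dotp !mulr_sumr -!sumrN -!big_split/=.
    by apply: eq_bigr => j _; rewrite /f /g; ring.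
  by rewrite !dotp_sphere uvE vwE; ring.
have := sum_CauchySchwarz f g; rewrite ff gg fg.
by rewrite (_ : (a * b - dotp u w) ^+ 2 = (dotp u w - a * b) ^+ 2)//; ring.
Qed.

HB.instance Definition _ n := isMetric.Build R (sphere n)
  (@sphere_distxx n) (@sphere_dist_eq0 n) (@sphere_distC n)
  (@sphere_dist_triangle n).

Let e0 n : n.+1.-tuple R := [tuple (i == ord0)%:R | i < n.+1].

Let e0_sphere n : dotp (e0 n) (e0 n) == 1.
Proof.
rewrite /dotp big_ord_recl big1 => [|i _]; rewrite !tnth_mktuple ?mulr1 ?addr0//.
by rewrite mulr0.
Qed.

Definition sphere_pole n : sphere n := Sphere (e0 n) (e0_sphere n).

HB.instance Definition _ n := isPointed.Build (sphere n) (sphere_pole n).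

End euclidean.
Arguments sphere R n : clear implicits.

Section lebesgue_tuple.
Context {R : realType}.
Local Notation RT := (measurableTypeR R).

(* n-dimensional Lebesgue measure, by slicing along the first coordinate. *)
Fixpoint lebesgue_tuple n : set (n.-tuple RT) -> \bar R :=
  match n with
  | 0 => fun A => \d_[tuple] A
  | m.+1 => fun A => (\int[@lebesgue_measure R]_x
         lebesgue_tuple [set t : m.-tuple RT | A [tuple of x :: t]])%E
  end.

Definition cube n (r : R) : set (n.-tuple RT) :=
  [set x | forall i, `|tnth x i| <= r].

Lemma measurable_cube n r : measurable (@cube n r).
Proof.
rewrite (_ : cube r = \bigcap_(i in [set: 'I_n])
    ((fun x : n.-tuple RT => tnth x i) @^-1` `[- r, r]%classic)).
  apply: fin_bigcap_measurable; first exact: finite_finset.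
  move=> i _; rewrite -[X in measurable X]setTI.
  by apply: measurable_tnth => //; exact: measurable_itv.
apply/seteqP; split => x /= xr i; first by rewrite /= ?in_itv/= -ler_norml.
by have := xr i Logic.I; rewrite /= ?in_itv/= -ler_norml.
Qed.

Let cons_pair n (z : RT * n.-tuple RT) : n.+1.-tuple RT :=
  [tuple of z.1 :: z.2].

Let measurable_cons_pair n : measurable_fun setT (@cons_pair n).
Proof. exact: measurable_cons. Qed.

Let cube_cover n : \bigcup_k @cube n k%:R = setT.
Proof.
apply/seteqP; split => // x _; exists (Num.bound (\sum_i `|tnth x i|)) => //= i.
apply: le_trans (ltW (archi_boundP _)); last by apply: sumr_ge0.
by rewrite (bigD1 i)//= lerDl sumr_ge0.
Qed.

Lemma lebesgue_tuple_ex n :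
  exists2 mu : {sigma_finite_measure set (n.-tuple RT) -> \bar R},
    (mu : set _ -> _) = @lebesgue_tuple n &
    forall r, 0 <= r -> mu (cube r) = ((2 * r) ^+ n)%:E.
Proof.
elim: n => [|n [mu muE muC]].
  exists (dirac [tuple]); first by [].
  by move=> r r0 /=; rewrite diracE mem_set//; case.
pose nu := pushforward (lebesgue_measure \x mu)%E (@cons_pair n).
have nuC r : 0 <= r -> nu (cube r) = ((2 * r) ^+ n.+1)%:E.
  move=> r0; rewrite /nu /pushforward.
  rewrite (_ : _ @^-1` _ = `[- r, r]%classic `*` cube r).
    rewrite product_measure1E//; last exact: measurable_cube.
    rewrite muC//; transitivity ((2 * r)%:E * ((2 * r) ^+ n)%:E)%E; last first.
      by rewrite -EFinM exprS.
    congr (_ * _)%E; have := lebesgue_measure_itv `[- r, r]%R => /= ->.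
    rewrite lte_fin; have [rr|rr] := ltP (- r) r.
      by rewrite -EFinD opprK; congr (_%:E); ring.
    by have -> : r = 0 by [lra]; rewrite mulr0.
  apply/seteqP; split => [[x t] /= h|[x t] /= [xr h] i].
    split; first by have := h ord0; rewrite /= ?in_itv/= -ler_norml.
    by move=> i; have := h (lift ord0 i); rewrite tnthS.
  case: (unliftP ord0 i) => [j ->|->]; first by rewrite tnthS.
  by move: xr; rewrite /= ?in_itv/= -ler_norml.
pose nu_ : {measure set _ -> \bar R} :=
  measure_function_pushforward__canonical__measure_function_Measure
    (lebesgue_measure \x mu)%E (@measurable_cons_pair n).
have nu_sf : sigma_finite setT nu.
  exists (fun k => cube k%:R); first by rewrite cube_cover.
  move=> k; split; first exact: measurable_cube.
  by rewrite nuC// ltry.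
have nu_sf' : sigma_finite setT nu_ by [].
pose nus : {sigma_finite_measure set _ -> \bar R} :=
  HB.pack (Measure.sort nu_) nu_
    (Measure_isSigmaFinite.Build _ _ _ nu_ nu_sf').
exists nus => //=.
apply/funext => A; rewrite /nus /= /nu /pushforward /=.
apply: eq_integral => x _; rewrite /= -muE; congr (mu _).
by apply/seteqP; split => t; rewrite /xsection/= inE.
Qed.
End lebesgue_tuple.

Section nvol.
Context {R : realType}.
Local Notation RT := (measurableTypeR R).

Lemma lebesgue_tuple_cube n (r : R) : 0 <= r ->
  lebesgue_tuple (@cube R n r) = ((2 * r) ^+ n)%:E.
Proof. by case: (@lebesgue_tuple_ex R n) => mu <- muC; exact: muC. Qed.

Let lebesgue_tuple0 n : @lebesgue_tuple R n set0 = 0%E.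
Proof. by case: (@lebesgue_tuple_ex R n) => mu <- _; exact: measure0. Qed.

Let lebesgue_tuple_ge0 n A : (0 <= @lebesgue_tuple R n A)%E.
Proof. by case: (@lebesgue_tuple_ex R n) => mu <- _; exact: measure_ge0. Qed.

Let lebesgue_tuple_sigma_additive n : semi_sigma_additive (@lebesgue_tuple R n).
Proof.
by case: (@lebesgue_tuple_ex R n) => mu <- _; exact: measure_semi_sigma_additive.
Qed.

HB.instance Definition _ n := isMeasure.Build _ _ _ (@lebesgue_tuple R n)
  (@lebesgue_tuple0 n) (@lebesgue_tuple_ge0 n) (@lebesgue_tuple_sigma_additive n).

Let lebesgue_tuple_sigma_finite n : sigma_finite setT (@lebesgue_tuple R n).
Proof. by case: (@lebesgue_tuple_ex R n) => mu <- _; exact: sigma_finiteT. Qed.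

HB.instance Definition _ n := Measure_isSigmaFinite.Build _ _ _
  (@lebesgue_tuple R n) (@lebesgue_tuple_sigma_finite n).

Lemma measurable_dotp d (T : measurableType d) n (f g : T -> n.-tuple RT) :
  measurable_fun setT f -> measurable_fun setT g ->
  measurable_fun setT (fun x => dotp (f x) (g x) : RT).
Proof.
move=> mf mg; apply: (@measurable_sum _ _ R) => i.
apply: measurable_funM.
- exact: (measurableT_comp (measurable_tnth i)).
- exact: (measurableT_comp (measurable_tnth i)).
Qed.

Definition unit_ball n : set (n.-tuple RT) := [set x | dotp x x <= 1].
Arguments unit_ball : clear implicits.

Lemma measurable_unit_ball n : measurable (unit_ball n).
Proof.
have m := @measurable_dotp _ _ n id id (@measurable_id _ _ _) (@measurable_id _ _ _).
have := m measurableT `]-oo, 1]%classic (measurable_itv _); rewrite setTI.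
by congr measurable; apply/seteqP; split => x /=; rewrite in_itv.
Qed.

Lemma unit_ball_lty n : (lebesgue_tuple (unit_ball n) < +oo)%E.
Proof.
apply: (@le_lt_trans _ _ (lebesgue_tuple (cube 1))).
  apply: le_measure; rewrite ?inE; [exact: measurable_unit_ball|exact: measurable_cube|].
  move=> x /= x1 i; rewrite -(@ler_pXn2r _ 2)// ?nnegrE// expr1n -normrX.
  rewrite ger0_norm ?sqr_ge0//; apply: le_trans x1.
  rewrite /dotp (bigD1 i)//= -expr2 lerDl sumr_ge0// => j _.
  by rewrite -expr2 sqr_ge0.
by rewrite lebesgue_tuple_cube// ltry.
Qed.

Lemma unit_ball_gt0 n : (0 < lebesgue_tuple (unit_ball n))%E.
Proof.
have r0 : 0 < n.+1%:R^-1 :> R by rewrite invr_gt0.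
apply: (@lt_le_trans _ _ (lebesgue_tuple (cube n.+1%:R^-1))).
  by rewrite lebesgue_tuple_cube ?(ltW r0)// lte_fin exprn_gt0// mulr_gt0.
apply: le_measure; rewrite ?inE; [exact: measurable_cube|exact: measurable_unit_ball|].
move=> x /= xr.
apply: (@le_trans _ _ (\sum_(i < n) n.+1%:R^-1)).
  apply: ler_sum => i _; rewrite -expr2 -[leLHS]ger0_norm ?sqr_ge0// normrX.
  apply: le_trans (xr i); rewrite expr2 -[leRHS]mulr1 ler_wpM2l//.
  by apply: le_trans (xr i) _; rewrite invf_le1// ler1n.
rewrite sumr_const card_ord -[_ *+ n]mulr_natl ler_pdivrMr// mul1r ler_nat.
exact: leqnSn.
Qed.

(* x / |x|; the value at the origin is irrelevant, the origin being a null
   set. *)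
Definition sphere_proj n (x : n.+1.-tuple RT) : borel (sphere R n) :=
  insubd (sphere_pole n) [tuple tnth x i / Num.sqrt (dotp x x) | i < n.+1].

Lemma sphere_projE n (x : n.+1.-tuple RT) i : 0 < dotp x x ->
  tnth (sphere_proj x : sphere R n) i = tnth x i / Num.sqrt (dotp x x).
Proof.
move=> x0; rewrite /sphere_proj val_insubd ifT ?tnth_mktuple//.
rewrite /dotp; under eq_bigr do rewrite !tnth_mktuple mulrACA.
rewrite -mulr_suml -/(dotp x x) -expr2 exprVn sqr_sqrtr ?(ltW x0)//.
by rewrite divff// gt_eqF.
Qed.

Lemma sphere_proj_pole n (x : n.+1.-tuple RT) : ~~ (0 < dotp x x) ->
  sphere_proj x = sphere_pole n.
Proof.
rewrite -leNgt => x0; have {}x0 : dotp x x = 0.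
  by apply/eqP; rewrite eq_le x0 dotp_ge0.
apply/val_inj; rewrite /sphere_proj val_insubd ifF//.
rewrite x0 sqrtr0 invr0 /dotp big1 => [|i _]; first by rewrite eq_sym oner_eq0.
by rewrite !tnth_mktuple mulr0 mul0r.
Qed.

Lemma measurable_sphere_proj_val n :
  measurable_fun setT (fun x => sphere_val (sphere_proj x) : n.+1.-tuple RT).
Proof.
apply/measurable_fun_tnthP => i.
have mn : measurable_fun setT (fun x : n.+1.-tuple RT => dotp x x : RT).
  by apply: measurable_dotp; exact: measurable_id.
rewrite (_ : _ \o _ = fun x : n.+1.-tuple RT => if 0 < dotp x x
   then tnth x i * (dotp x x `^ (- 2^-1)) else tnth (sphere_pole n) i :> R).
  apply: measurable_fun_ifT => //.
  - exact: measurable_fun_ltr.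
  - apply: measurable_funM; first exact: measurable_tnth.
    exact: (measurableT_comp (measurable_powR _)).
apply/funext => x /=; case: ifPn => x0; last by rewrite sphere_proj_pole.
by rewrite sphere_projE// powRN powR12_sqrt// ltW.
Qed.

Lemma sphere_coord_le1 n (u : sphere R n) i : `|tnth u i| <= 1.
Proof.
rewrite -(@ler_pXn2r _ 2)// ?nnegrE// expr1n -normrX ger0_norm ?sqr_ge0//.
rewrite -(dotp_sphere u) /dotp (bigD1 i)//= -expr2 lerDl sumr_ge0// => j _.
by rewrite -expr2 sqr_ge0.
Qed.

Let rat_tuple n (q : n.-tuple rat) : n.-tuple RT :=
  [tuple (ratr (tnth q i) : R) | i < n].

Let sphere_dist_lt n (u v : sphere R n) (e : R) : 0 < e -> e <= pi ->
  (sphere_dist u v < e) = (cos e < dotp u v).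
Proof.
move=> e0 epi; rewrite -cos_sphere_dist ltr_cos ?in_itv/=
  ?sphere_dist_ge0 ?sphere_dist_lepi ?(ltW e0) ?epi//.
Qed.

Let sphere_proj_dense n (u : sphere R n) (e : R) : 0 < e -> e <= pi ->
  exists q : n.+1.-tuple rat, sphere_dist u (sphere_proj (rat_tuple q)) < e.
Proof.
move=> e0 epi; set c := cos e.
have c1 : c < 1 by rewrite -cos0 ltr_cos// in_itv/= ?lexx ?pi_ge0// (ltW e0).
have cN1 : -1 <= c by exact: cos_geN1.
pose t := (1 - c) / 4; pose d := t / n.+1%:R.
have t0 : 0 < t by rewrite divr_gt0// subr_gt0.
have t12 : t <= 2^-1 by rewrite /t; lra.
have d0 : 0 < d by rewrite divr_gt0.
have nd : \sum_(i < n.+1) d = t.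
  by rewrite sumr_const card_ord -mulr_natr divfK.
have dt : d <= t by rewrite ler_pdivrMr// ler_peMr ?(ltW t0)// ler1n.
have /(@fin_all_exists _ (fun=> rat)) [q qP] : forall i : 'I_n.+1, exists q : rat,
    `|tnth u i - ratr q| < d.
  move=> i; have /rat_in_itvoo[q] : tnth u i - d < tnth u i + d by lra.
  by rewrite in_itv/= => /andP[? ?]; exists q; rewrite ltr_norml; lra.
exists [tuple q i | i < n.+1].
set x := rat_tuple _.
have xE i : tnth x i = ratr (q i) by rewrite !tnth_mktuple.
pose h i := tnth u i - tnth x i.
have hd i : `|h i| <= d by rewrite ltW// /h xE.
have uh : `|\sum_i tnth u i * h i| <= t.
  apply: le_trans (ler_norm_sum _ _ _) _; rewrite -nd; apply: ler_sum => i _.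
  by rewrite normrM -[leRHS]mul1r ler_pM// sphere_coord_le1.
have hh : \sum_i h i ^+ 2 <= t.
  rewrite -nd; apply: ler_sum => i _; rewrite -[leLHS]ger0_norm ?sqr_ge0//.
  rewrite normrX expr2 -[leRHS]mul1r ler_pM//.
  by apply: le_trans (hd i) _; lra.
have sE : dotp u x = 1 - \sum_i tnth u i * h i.
  rewrite -(dotp_sphere u) /dotp -sumrB; apply: eq_bigr => i _.
  by rewrite /h; ring.
have xxE : dotp x x = 1 - (\sum_i tnth u i * h i) *+ 2 + \sum_i h i ^+ 2.
  rewrite -(dotp_sphere u) /dotp -sumrMnl -sumrN -!big_split/=.
  by apply: eq_bigr => i _; rewrite /h; ring.
move: uh; rewrite ler_norml => /andP[uh1 uh2].
have s0 : 0 < dotp u x by rewrite sE; lra.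
have xx0 : 0 < dotp x x.
  have := dotp_CauchySchwarz u x; rewrite dotp_sphere mul1r.
  by apply: lt_le_trans; rewrite exprn_gt0.
have sq : Num.sqrt (dotp x x) <= 1 + 2 * t.
  rewrite -[leRHS]ger0_norm; last by lra.
  by rewrite -sqrtr_sqr ler_wsqrtr// xxE; nra.
rewrite sphere_dist_lt// -/c.
rewrite (_ : dotp u _ = dotp u x / Num.sqrt (dotp x x)); last first.
  rewrite /dotp mulr_suml; apply: eq_bigr => i _.
  by rewrite sphere_projE// mulrA.
rewrite ltr_pdivlMr ?sqrtr_gt0//.
have := sqrtr_ge0 (dotp x x); move: (Num.sqrt _) sq => r r1 r0.
have -> : c = 1 - 4 * t by rewrite /t; lra.
rewrite sE.
have [c0|c0] := leP (1 - 4 * t) 0; first by nra.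
by nra.
Qed.

Lemma measurable_sphere_proj n : measurable_fun setT (@sphere_proj n).
Proof.
apply: (@measurability _ _ (n.+1.-tuple RT) (borel (sphere R n)) setT
  (@sphere_proj n) open) => //.
move=> _ [U oU <-]; rewrite setTI.
pose r k : R := k.+1%:R^-1.
pose B (i : n.+1.-tuple rat * nat) : set (sphere R n) :=
  [set v | sphere_dist v (sphere_proj (rat_tuple i.1)) < r i.2].
pose I := [set i | r i.2 <= pi /\ B i `<=` U].
have UE : U = \bigcup_i (if i \in I then B i else set0).
  apply/seteqP; split => [u Uu|u [i _]]; last first.
    by case: ifPn => //; rewrite inE => -[_]; exact.
  have : nbhs (u : sphere R n) U by apply: open_nbhs_nbhs.
  rewrite -nbhs_ballE => -[e /= e0 eU].
  have [k rk] : exists k, r k < Num.min pi (e / 2).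
    have /ltr_add_invr[k] : 0 < Num.min pi (e / 2).
      by rewrite lt_min pi_gt0 divr_gt0.
    by rewrite add0r; exists k.
  move: rk; rewrite lt_min => /andP[rpi re].
  have [q uq] := @sphere_proj_dense n u (r k) ltac:(by rewrite invr_gt0) (ltW rpi).
  exists (q, k) => //; rewrite ifT//= inE; split; first exact: ltW.
  move=> v /= vq; apply: eU; rewrite /ball/=.
  apply: le_lt_trans (sphere_dist_triangle (sphere_proj (rat_tuple q)) _ _) _.
  by rewrite (sphere_distC _ v); rewrite /B/= in vq; lra.
rewrite UE preimage_bigcup; apply: countable_bigcupT_measurable => // i.
case: ifPn; last by rewrite preimage_set0.
rewrite inE => -[ipi _]; set p : sphere R n := sphere_proj (rat_tuple i.1).
have m := @measurable_dotp _ _ n.+1 _ _ (@measurable_sphere_proj_val n)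
  (@measurable_cst _ _ _ _ setT (p : n.+1.-tuple RT)).
have := m measurableT `]cos (r i.2), +oo[%classic (measurable_itv _).
rewrite setTI; congr measurable; apply/seteqP; split => x /=.
  by rewrite in_itv/= andbT /B/= sphere_dist_lt// invr_gt0.
by rewrite in_itv/= andbT /B/= sphere_dist_lt// invr_gt0.
Qed.

(* The normalized volume of A is the proportion of the unit ball occupied by
   the cone { r u | 0 < r <= 1, u in A } over A: in polar coordinates
   dx = r^n dr dvol(u), the surface volume of A is n+1 times the Lebesgue
   measure of this cone. *)
Definition nvol n (A : set (borel (sphere R n))) : \bar R :=
  ((fine (lebesgue_tuple (unit_ball n.+1)))^-1%:E *
   lebesgue_tuple (@sphere_proj n @^-1` A `&` unit_ball n.+1))%E.

Let nvol0 n : nvol (set0 : set (borel (sphere R n))) = 0%E.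
Proof. by rewrite /nvol preimage_set0 set0I measure0 mule0. Qed.

Let ball_vol_ge0 n : 0 <= fine (lebesgue_tuple (unit_ball n)).
Proof. by rewrite fine_ge0. Qed.

Let nvol_ge0 n (A : set (borel (sphere R n))) : (0 <= nvol A)%E.
Proof. by rewrite mule_ge0 ?lee_fin ?invr_ge0. Qed.

Let nvol_sigma_additive n : semi_sigma_additive (@nvol n).
Proof.
pose k : {nonneg R} :=
  NngNum (etrans (invr_ge0 _) (ball_vol_ge0 n.+1)).
pose nu : {measure set (n.+1.-tuple RT) -> \bar R} :=
  mrestr (@lebesgue_tuple R n.+1) (@measurable_unit_ball n.+1).
pose nup : {measure set (borel (sphere R n)) -> \bar R} :=
  measure_function_pushforward__canonical__measure_function_Measure
    nu (@measurable_sphere_proj n).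
exact: (@measure_semi_sigma_additive _ _ _ (mscale k nup)).
Qed.

HB.instance Definition _ n := isMeasure.Build _ _ _ (@nvol n)
  (@nvol0 n) (@nvol_ge0 n) (@nvol_sigma_additive n).

Let nvolT n : @nvol n setT = 1%E.
Proof.
rewrite /nvol preimage_setT setTI; move: (unit_ball_gt0 n.+1) (unit_ball_lty n.+1).
by case: lebesgue_tuple => //= v; rewrite lte_fin => v0 _; rewrite -EFinM mulVf ?gt_eqF.
Qed.

HB.instance Definition _ n := Measure_isProbability.Build _ _ _ (@nvol n) (@nvolT n).

End nvol.
Arguments unit_ball {R} n.
Arguments nvol R n : clear implicits.

(* Main.v *)
(** Put A(u,v) = pi/2 - d(u,v), so that sin A(u,v) = <u,v>. As the volume is
    rotation invariant, the cMDS kernel is (pi/2) A - A^2 / 2 + constant. The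
    power series of arcsin has nonnegative coefficients, hence A and A^2 are
    positive semidefinite kernels; A is odd and A^2 is even under the antipodal
    map, and the cMDS operator kills constants, so the eigenfunctions for positive
    eigenvalues are exactly those of the kernel P = (pi/2) A. Mercer's theorem
    gives sum_i lambda_i phi_i(u) phi_i(v) = P(u,v), whence
    |Phi(u) - Phi(v)|^2 = P(u,u) + P(v,v) - 2 P(u,v) = pi d(u,v).

    For Mercer's theorem, the residual P - sum_i lambda_i phi_i (x) phi_i is
    positive semidefinite; if it were not zero, power iteration would produce an
    eigenfunction of P orthogonal to all the phi_i.

    Rotation invariance of the volume comes from the translation invariance of
    Lebesgue measure and Tonelli's theorem, without any determinant. *)

Require Import Defs.
From mathcomp Require Import all_boot all_order all_algebra.
From mathcomp Require Import all_classical all_reals all_analysis.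
From mathcomp Require Import measurable_realfun ring lra.

Import Order.TTheory GRing.Theory Num.Theory numFieldNormedType.Exports.

Set Implicit Arguments.
Unset Strict Implicit.
Unset Printing Implicit Defensive.

Local Open Scope classical_set_scope.
Local Open Scope ring_scope.

(** * Integration of bounded measurable functions *)

(** The obstacle is pointwise information. The residual kernel in Mercer's theorem is a limit of
    partial sums, known only to be bounded and measurable, while the conclusion concerns every pair
    of points. Functions are therefore defined everywhere, and positivity is tested against Dirac
    masses as well as densities; this controls the diagonal and the value of an operator at each
    point. Almost everywhere identities become identities at the end, through continuity and the
    full support of the volume.

    In the power iteration the operator norm is a supremum that need not be attained a priori.
    Iterates are started at the sections [k w], and the Hilbert-Schmidt norm shows that for some [w]
    the rescaled iterates do not die out.

    The diagonal is the delicate place for arcsin as well: there [<u, u> = 1], the endpoint where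
    its derivative blows up. Hence the substitution [x = sin t] and a separate argument at
    [t = pi / 2]. *)

Section bounded_measurable.
Context d (T : measurableType d) (R : realType).
Implicit Types (f g : T -> R).

(** The bound holds everywhere, so that kernel operators act on genuine functions and have a value
    at each point. The class is stable under products, integration of one variable and bounded
    pointwise limits. *)
Definition bmeas f :=
  measurable_fun setT f /\ exists C, forall x, `|f x| <= C.

Lemma bmeas_cst (r : R) : bmeas (fun=> r).
Proof. by split; [exact: measurable_cst | exists `|r|]. Qed.

Lemma bmeasD f g : bmeas f -> bmeas g -> bmeas (fun x => f x + g x).
Proof.
move=> [mf [A fA]] [mg [B gB]]; split; first exact: measurable_funD.
by exists (A + B) => x; apply: le_trans (ler_normD _ _) _; exact: lerD.
Qed.

Lemma bmeasM f g : bmeas f -> bmeas g -> bmeas (fun x => f x * g x).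
Proof.
move=> [mf [A fA]] [mg [B gB]]; split; first exact: measurable_funM.
by exists (A * B) => x; rewrite normrM ler_pM.
Qed.

Lemma bmeasZ (r : R) f : bmeas f -> bmeas (fun x => r * f x).
Proof. by apply: bmeasM; exact: bmeas_cst. Qed.

Lemma bmeasN f : bmeas f -> bmeas (fun x => - f x).
Proof. by move=> [mf [A fA]]; split; [exact: measurable_funN|exists A => x; rewrite normrN]. Qed.

Lemma bmeasB f g : bmeas f -> bmeas g -> bmeas (fun x => f x - g x).
Proof. by move=> bf bg; apply: bmeasD => //; exact: bmeasN. Qed.

Lemma bmeasX f n : bmeas f -> bmeas (fun x => f x ^+ n).
Proof.
move=> bf; elim: n => [|n ih]; first exact: bmeas_cst.
by under eq_fun do rewrite exprS; exact: bmeasM.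
Qed.

Lemma bmeas_sum (I : Type) (s : seq I) (F : I -> T -> R) :
  (forall i, bmeas (F i)) -> bmeas (fun x => \sum_(i <- s) F i x).
Proof.
move=> bF; elim: s => [|i s ih].
  by under eq_fun do rewrite big_nil; exact: bmeas_cst.
by under eq_fun do rewrite big_cons; exact: bmeasD.
Qed.

Lemma bmeas_cvg (F : nat -> T -> R) f (C : R) :
  (forall n, measurable_fun setT (F n)) -> (forall n x, `|F n x| <= C) ->
  (forall x, F ^~ x @ \oo --> f x) -> bmeas f.
Proof.
move=> mF FC Ff; split.
  by apply: (measurable_fun_cvg mF) => x _; exact: Ff.
exists C => x; have /(_ _) h := cvg_norm (Ff x).
by rewrite -(cvg_lim _ h)//; apply: limr_le; [exact: cvgP h|exact: nearW].
Qed.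

End bounded_measurable.

Lemma bmeas_comp d1 d2 (S : measurableType d1) (T : measurableType d2)
    (R : realType) (g : S -> T) (f : T -> R) :
  measurable_fun setT g -> bmeas f -> bmeas (fun x => f (g x)).
Proof.
by move=> mg [mf [A fA]]; split; [exact: measurableT_comp|exists A => x].
Qed.

Lemma ae_imp d (T : measurableType d) (R : realType) (mu : {measure set T -> \bar R})
    (P Q : T -> Prop) : (forall x, P x -> Q x) ->
  {ae mu, forall x, P x} -> {ae mu, forall x, Q x}.
Proof. by move=> PQ; apply: filterS. Qed.

Section bounded_measurable_integral.
Context d (T : measurableType d) (R : realType) (mu : probability T R).
Implicit Types (f g : T -> R).

Lemma bmeas_integrable f : bmeas f -> mu.-integrable setT (EFin \o f).
Proof.
move=> [mf [A fA]]; apply: measurable_bounded_integrable => //.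
  by have := ltry (1 : R); rewrite -(probability_setT mu).
by exists A; split; [exact: num_real|move=> B AB x _; apply: le_trans (fA x) (ltW AB)].
Qed.

Lemma Rint_cst (r : R) : \int[mu]_x r = r.
Proof.
rewrite Rintegral_cst// [X in fine X](_ : _ = 1%E) ?mulr1//.
exact: probability_setT.
Qed.

Lemma RintD f g : bmeas f -> bmeas g ->
  \int[mu]_x (f x + g x) = \int[mu]_x f x + \int[mu]_x g x.
Proof. by move=> bf bg; rewrite RintegralD//; exact: bmeas_integrable. Qed.

Lemma RintB f g : bmeas f -> bmeas g ->
  \int[mu]_x (f x - g x) = \int[mu]_x f x - \int[mu]_x g x.
Proof. by move=> bf bg; rewrite RintegralB//; exact: bmeas_integrable. Qed.

Lemma RintZl (r : R) f : bmeas f -> \int[mu]_x (r * f x) = r * \int[mu]_x f x.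
Proof. by move=> bf; rewrite RintegralZl//; exact: bmeas_integrable. Qed.

Lemma RintZr (r : R) f : bmeas f -> \int[mu]_x (f x * r) = \int[mu]_x f x * r.
Proof. by move=> bf; rewrite RintegralZr//; exact: bmeas_integrable. Qed.

Lemma RintN f : bmeas f -> \int[mu]_x (- f x) = - \int[mu]_x f x.
Proof.
move=> bf; rewrite -mulN1r -RintZl//.
by congr Rintegral; apply/funext => x; rewrite mulN1r.
Qed.

Lemma Rint_sum (I : Type) (s : seq I) (F : I -> T -> R) :
  (forall i, bmeas (F i)) ->
  \int[mu]_x (\sum_(i <- s) F i x) = \sum_(i <- s) \int[mu]_x F i x.
Proof.
move=> bF; elim: s => [|i s ih].
  by rewrite big_nil -[RHS]Rint_cst; apply: eq_Rintegral => x _; rewrite big_nil.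
rewrite big_cons -ih -RintD//; last exact: bmeas_sum.
by apply: eq_Rintegral => x _; rewrite big_cons.
Qed.

Lemma le_Rint f g : bmeas f -> bmeas g -> (forall x, f x <= g x) ->
  \int[mu]_x f x <= \int[mu]_x g x.
Proof.
by move=> bf bg fg; apply: le_Rintegral => //; exact: bmeas_integrable.
Qed.

Lemma norm_Rint_le f (C : R) : bmeas f -> (forall x, `|f x| <= C) ->
  `|\int[mu]_x f x| <= C.
Proof.
move=> bf fC; rewrite ler_norml -{1}[C]Rint_cst -{2}[C]Rint_cst -RintN; last first.
  exact: bmeas_cst.
by apply/andP; split; apply: le_Rint => //; try exact: bmeas_cst;
  move=> x; have := fC x; rewrite ler_norml => /andP[].
Qed.

Lemma eq_Rint_ae f g : bmeas f -> bmeas g ->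
  {ae mu, forall x, f x = g x} -> \int[mu]_x f x = \int[mu]_x g x.
Proof.
move=> [mf _] [mg _] fg; rewrite /Rintegral; congr fine.
apply: ae_eq_integral => //; [exact/measurable_EFinP..|].
by move: fg; apply: filterS => x /= ->.
Qed.

Lemma Rint_eq0_ae f : bmeas f -> (forall x, 0 <= f x) ->
  \int[mu]_x f x = 0 -> {ae mu, forall x, f x = 0}.
Proof.
move=> bf f0 if0.
have h : (\int[mu]_x `|(f x)%:E| = 0)%E.
  under eq_integral do rewrite gee0_abs ?lee_fin//.
  rewrite -[LHS]fineK; last exact: integrable_fin_num (bmeas_integrable bf).
  by congr EFin.
have := (ae_eq_integral_abs mu measurableT (f := EFin \o f) _).1.
case: bf => mf _ /(_ ltac:(exact/measurable_EFinP) h).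
by apply: filterS => x /= /(_ Logic.I) [].
Qed.

Lemma Rint_dominated (F : nat -> T -> R) f (C : R) :
  (forall n, measurable_fun setT (F n)) -> (forall n x, `|F n x| <= C) ->
  (forall x, F ^~ x @ \oo --> f x) ->
  (fun n => \int[mu]_x F n x) @ \oo --> \int[mu]_x f x.
Proof.
move=> mF FC Ff; have bf := bmeas_cvg mF FC Ff.
have bF n : bmeas (F n) by split => //; exists C.
have [] := @dominated_convergence _ T R mu setT measurableT
  (fun n => EFin \o F n) (EFin \o f) (cst C%:E).
- by move=> n; exact/measurable_EFinP.
- by case: bf => ? _; exact/measurable_EFinP.
- by apply: aeW => x _; apply: cvg_EFin (Ff x); exact: nearW.
- exact: (bmeas_integrable (bmeas_cst _ C)).
- by apply: aeW => x n _ /=; rewrite lee_fin.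
move=> _ _ h; apply: fine_cvg; rewrite fineK//.
exact: integrable_fin_num (bmeas_integrable bf).
Qed.

Lemma Rint_CauchySchwarz f g : bmeas f -> bmeas g ->
  (\int[mu]_x (f x * g x)) ^+ 2 <=
  (\int[mu]_x (f x ^+ 2)) * (\int[mu]_x (g x ^+ 2)).
Proof.
move=> bf bg; set a := \int[mu]_x (f x ^+ 2); set b := \int[mu]_x (f x * g x).
set c := \int[mu]_x (g x ^+ 2).
have q s t : 0 <= s ^+ 2 * a + 2 * s * t * b + t ^+ 2 * c.
  suff -> : s ^+ 2 * a + 2 * s * t * b + t ^+ 2 * c =
      \int[mu]_x ((s * f x + t * g x) ^+ 2).
    by apply: Rintegral_ge0 => x _; exact: sqr_ge0.
  rewrite -RintZl; last exact: bmeasX.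
  rewrite -[2 * s * t * b]RintZl; last exact: bmeasM.
  rewrite -[t ^+ 2 * c]RintZl; last exact: bmeasX.
  rewrite -!RintD; [|by repeat (apply: bmeasX || apply: bmeasZ || apply: bmeasD ||
     apply: bmeasM)..].
  by apply: eq_Rintegral => x _; ring.
have c0 : 0 <= c by apply: Rintegral_ge0 => x _; exact: sqr_ge0.
have a0 : 0 <= a by apply: Rintegral_ge0 => x _; exact: sqr_ge0.
have [c_gt0|c_le0] := ltP 0 c.
  (* For [s = c] the form is minimal at [t = - b]. *)
  have := q c (- b).
  rewrite (_ : _ + _ = c * (a * c - b ^+ 2)); last by ring.
  by rewrite pmulr_rge0// subr_ge0.
have {}c0 : c = 0 by lra.
have [->|b0] := eqVneq b 0; first by rewrite expr0n/= c0 mulr0.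
(* With [c = 0] the form is affine in [t]; this [t] gives it the value -1. *)
have := q 1 (- (a + 1) / (2 * b)).
rewrite c0 (_ : _ + _ = - 1); last by field.
by rewrite lerNr oppr0 ler10.
Qed.

End bounded_measurable_integral.

Section fubini_bounded.
Context d1 d2 (S : measurableType d1) (T : measurableType d2) (R : realType).
Variables (mu : probability S R) (nu : probability T R).

Lemma bmeas_section1 (f : S * T -> R) x : bmeas f -> bmeas (fun y => f (x, y)).
Proof. by apply: bmeas_comp; exact: measurable_pair1. Qed.

Lemma bmeas_section2 (f : S * T -> R) y : bmeas f -> bmeas (fun x => f (x, y)).
Proof. by apply: bmeas_comp; exact: measurable_pair2. Qed.

Let bmeas_integrable2 (f : S * T -> R) : bmeas f ->
  (mu \x nu)%E.-integrable setT (EFin \o f).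
Proof.
move=> [mf [C fC]]; apply: measurable_bounded_integrable => //; last first.
  exists C; split; first exact: num_real.
  by move=> B AB x _; apply: le_trans (fC x) (ltW AB).
rewrite [ltLHS](_ : _ = 1%E) ?ltry// -setXTT.
apply: etrans (product_measure1E _ _ measurableT measurableT) _.
rewrite -[RHS]mule1; congr (_ * _)%E; exact: probability_setT.
Qed.

Lemma bmeas_Rint (f : S * T -> R) : bmeas f ->
  bmeas (fun x => \int[nu]_y f (x, y)).
Proof.
move=> bf; split; last first.
  case: (bf) => _ [C fC]; exists C => x; apply: norm_Rint_le => //.
  exact: bmeas_section1.
have if' := bmeas_integrable2 bf.
have := measurable_fubini_F if'.
rewrite (_ : fubini_F _ _ = EFin \o (fun x => \int[nu]_y f (x, y))).
  by move/measurable_EFinP.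
apply/funext => x /=; rewrite fineK//.
exact: integrable_fin_num (bmeas_integrable nu (bmeas_section1 x bf)).
Qed.

Lemma Rint_Fubini (f : S * T -> R) : bmeas f ->
  \int[mu]_x \int[nu]_y f (x, y) = \int[nu]_y \int[mu]_x f (x, y).
Proof.
move=> bf.
have if' := bmeas_integrable2 bf.
have := Fubini if'; rewrite {1 2}/Rintegral => h.
rewrite /Rintegral; congr fine.
transitivity (\int[mu]_x \int[nu]_y (f (x, y))%:E)%E.
  apply: eq_integral => x _; rewrite fineK//.
  exact: integrable_fin_num (bmeas_integrable nu (bmeas_section1 x bf)).
rewrite h; apply: eq_integral => y _; rewrite fineK//.
exact: integrable_fin_num (bmeas_integrable mu (bmeas_section2 y bf)).
Qed.

End fubini_bounded.

(** * Kernel operators and positive semidefinite kernels *)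

Section kernel_operator.
Context d (T : measurableType d) (R : realType) (mu : probability T R).
Implicit Types (f g : T -> R) (k : T -> T -> R).

Definition bkernel k := bmeas (fun z : T * T => k z.1 z.2).

Definition kop k f : T -> R := fun u => \int[mu]_v (k u v * f v).

Definition iprod f g : R := \int[mu]_x (f x * g x).

Lemma ipC f g : iprod f g = iprod g f.
Proof. by apply: eq_Rintegral => x _; rewrite mulrC. Qed.

Lemma ip_ge0 f : 0 <= iprod f f.
Proof. by apply: Rintegral_ge0 => x _; rewrite -expr2 sqr_ge0. Qed.

Lemma ipDl f g h : bmeas f -> bmeas g -> bmeas h ->
  iprod (fun x => f x + g x) h = iprod f h + iprod g h.
Proof.
move=> bf bg bh; rewrite /iprod -RintD; [|exact: bmeasM..].
by apply: eq_Rintegral => x _; rewrite mulrDl.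
Qed.

Lemma ipDr f g h : bmeas f -> bmeas g -> bmeas h ->
  iprod h (fun x => f x + g x) = iprod h f + iprod h g.
Proof. by move=> bf bg bh; rewrite ipC ipDl// ipC [iprod g h]ipC. Qed.

Lemma ipZl c f h : bmeas f -> bmeas h -> iprod (fun x => c * f x) h = c * iprod f h.
Proof.
move=> bf bh; rewrite /iprod -RintZl; last exact: bmeasM.
by apply: eq_Rintegral => x _; rewrite mulrA.
Qed.

Lemma ipZr c f h : bmeas f -> bmeas h -> iprod h (fun x => c * f x) = c * iprod h f.
Proof. by move=> bf bh; rewrite ipC ipZl// ipC. Qed.

Lemma ip_CauchySchwarz f g : bmeas f -> bmeas g ->
  iprod f g ^+ 2 <= iprod f f * iprod g g.
Proof. by move=> bf bg; exact: Rint_CauchySchwarz. Qed.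

Lemma ip_eq0 f g : bmeas f -> bmeas g -> iprod f f = 0 -> iprod f g = 0.
Proof.
move=> bf bg ff0; apply/eqP; rewrite -sqrf_eq0 eq_le sqr_ge0 andbT.
by have := ip_CauchySchwarz bf bg; rewrite ff0 mul0r.
Qed.

Lemma ip_norm_le f (C : R) : bmeas f -> (forall x, `|f x| <= C) ->
  iprod f f <= C ^+ 2.
Proof.
move=> bf fC; apply: le_trans (ler_norm _) _.
apply: norm_Rint_le => [|x]; first exact: bmeasM.
by rewrite normrM expr2 ler_pM.
Qed.

Lemma bkernel_l k u : bkernel k -> bmeas (k u).
Proof. exact: (@bmeas_section1 _ _ _ _ _ (fun z => k z.1 z.2)). Qed.

Lemma bkernel_prod f g : bmeas f -> bmeas g -> bkernel (fun u v => f u * g v).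
Proof.
move=> bf bg; apply: bmeasM.
- by apply: (bmeas_comp _ bf); exact: measurable_fst.
- by apply: (bmeas_comp _ bg); exact: measurable_snd.
Qed.

Lemma bmeas_kop k f : bkernel k -> bmeas f -> bmeas (kop k f).
Proof.
move=> bk bf.
apply: (@bmeas_Rint _ _ T T R mu mu (fun z => k z.1 z.2 * f z.2)).
by apply: bmeasM => //; apply: (bmeas_comp _ bf); exact: measurable_snd.
Qed.

Lemma kopD k f g u : bkernel k -> bmeas f -> bmeas g ->
  kop k (fun x => f x + g x) u = kop k f u + kop k g u.
Proof. by move=> bk bf bg; apply: ipDr => //; exact: bkernel_l. Qed.

Lemma kopZ k c f u : bkernel k -> bmeas f ->
  kop k (fun x => c * f x) u = c * kop k f u.
Proof. by move=> bk bf; apply: ipZr => //; exact: bkernel_l. Qed.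

Lemma kop_sym k f g : bkernel k -> (forall u v, k u v = k v u) ->
  bmeas f -> bmeas g -> iprod (kop k f) g = iprod f (kop k g).
Proof.
move=> bk sk bf bg; rewrite /iprod /kop.
transitivity (\int[mu]_u \int[mu]_v (k u v * f v * g u)).
  apply: eq_Rintegral => u _; rewrite RintZr//.
  by apply: bmeasM => //; exact: bkernel_l.
rewrite (@Rint_Fubini _ _ T T R mu mu (fun z => k z.1 z.2 * f z.2 * g z.1)).
  apply: eq_Rintegral => v _; rewrite /= -RintZl; last first.
    by apply: bmeasM => //; exact: bkernel_l.
  by apply: eq_Rintegral => u _; rewrite sk; ring.
apply: bmeasM; first apply: bmeasM => //.
- by apply: (bmeas_comp _ bf); exact: measurable_snd.
- by apply: (bmeas_comp _ bg); exact: measurable_fst.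
Qed.

Lemma kop_CauchySchwarz k f u : bkernel k -> bmeas f ->
  kop k f u ^+ 2 <= iprod (k u) (k u) * iprod f f.
Proof. by move=> bk bf; apply: ip_CauchySchwarz => //; exact: bkernel_l. Qed.

(* Positivity of [k] as a quadratic form on the measures [c delta_u + f mu]; the
   Dirac mass gives access to the pointwise values [k u u] and [kop k f u]. *)
Definition psd_kernel k := forall c u f, bmeas f ->
  0 <= c ^+ 2 * k u u + 2 * c * kop k f u + iprod (kop k f) f.

Lemma psd_diag k u : psd_kernel k -> 0 <= k u u.
Proof.
move=> /(_ 1 u (fun=> 0) (bmeas_cst _ 0)); rewrite /iprod /kop.
rewrite (_ : (fun v => _) = fun=> 0); last by apply/funext => v; rewrite mulr0.
rewrite (_ : (fun v => _ * 0) = fun=> 0); last by apply/funext => v; rewrite mulr0.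
by rewrite !Rint_cst expr1n mul1r mulr0 !addr0.
Qed.

Lemma psd_ip_ge0 k f : psd_kernel k -> bmeas f -> 0 <= iprod (kop k f) f.
Proof.
by move=> pk bf; have := pk 0 point f bf; rewrite expr0n/= mulr0 !mul0r !add0r.
Qed.

(** A function of zero energy is annihilated at every point: the Dirac part of the form turns an
    integral condition into a pointwise one. *)
Lemma psd_kop_eq0 k f u : psd_kernel k -> bmeas f ->
  iprod (kop k f) f = 0 -> kop k f u = 0.
Proof.
(* The minimizer of the form in [c] would be [- x / a]; the shift by 1 covers [a = 0]. *)
move=> pk bf kf0; have := pk (- kop k f u / (k u u + 1)) u f bf.
have := psd_diag u pk; rewrite kf0; set x := kop k f u; set a := k u u => a0.
have a1 : a + 1 != 0 by rewrite gt_eqF// ltr_wpDl.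
rewrite (_ : _ + _ = - (x ^+ 2 * ((a + 2) / (a + 1) ^+ 2))); last by field.
rewrite oppr_ge0 pmulr_lle0; last by rewrite divr_gt0 ?exprn_gt0 ?ltr_wpDl.
by move=> x0; apply/eqP; rewrite -sqrf_eq0 eq_le x0 sqr_ge0.
Qed.

Lemma psd_cst1 : psd_kernel (fun _ _ => 1).
Proof.
move=> c u f bf.
have -> : kop (fun _ _ => 1) f = fun=> \int[mu]_x f x.
  by apply/funext => x; apply: eq_Rintegral => v _; rewrite mul1r.
rewrite /iprod RintZl// (_ : _ + _ = (c + \int[mu]_x f x) ^+ 2) ?sqr_ge0//.
by ring.
Qed.

Lemma psdD k1 k2 : bkernel k1 -> bkernel k2 ->
  psd_kernel k1 -> psd_kernel k2 -> psd_kernel (fun u v => k1 u v + k2 u v).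
Proof.
move=> b1 b2 p1 p2 c u f bf.
have E x : kop (fun u v => k1 u v + k2 u v) f x = kop k1 f x + kop k2 f x.
  rewrite /kop -RintD; [|by apply: bmeasM => //; exact: bkernel_l..].
  by apply: eq_Rintegral => v _; rewrite mulrDl.
have -> : kop (fun u v => k1 u v + k2 u v) f = fun x => kop k1 f x + kop k2 f x.
  by apply/funext.
rewrite ipDl//; [|exact: bmeas_kop..].
by have := addr_ge0 (p1 c u f bf) (p2 c u f bf); congr (_ <= _); ring.
Qed.

Lemma psdZ a k : 0 <= a -> bkernel k -> psd_kernel k ->
  psd_kernel (fun u v => a * k u v).
Proof.
move=> a0 bk pk c u f bf.
have -> : kop (fun u v => a * k u v) f = fun x => a * kop k f x.
  apply/funext => x; rewrite /kop -RintZl; last by apply: bmeasM => //; exact: bkernel_l.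
  by apply: eq_Rintegral => v _; rewrite mulrA.
rewrite ipZl//; last exact: bmeas_kop.
by have := mulr_ge0 a0 (pk c u f bf); congr (_ <= _); ring.
Qed.

(** The form of the new kernel at [(c, f)] is the form of [k] at [(c * g u, g * f)]. *)
Lemma psd_conj g k : bmeas g -> bkernel k -> psd_kernel k ->
  psd_kernel (fun u v => g u * g v * k u v).
Proof.
move=> bg bk pk c u f bf.
have bgf : bmeas (fun x => g x * f x) by exact: bmeasM.
have -> : kop (fun u v => g u * g v * k u v) f =
    fun x => g x * kop k (fun x => g x * f x) x.
  apply/funext => x; rewrite /kop -RintZl; last first.
    by apply: bmeasM => //; exact: bkernel_l.
  by apply: eq_Rintegral => v _; ring.
have := pk (c * g u) u _ bgf; congr (_ <= _).
rewrite (_ : iprod (fun x => _) f = iprod (kop k (fun x => g x * f x)) (fun x => g x * f x)).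
  by ring.
by apply: eq_Rintegral => x _; ring.
Qed.

Lemma psd_sum (I : Type) (s : seq I) (k : I -> T -> T -> R) :
  (forall i, bkernel (k i)) -> (forall i, psd_kernel (k i)) ->
  psd_kernel (fun u v => \sum_(i <- s) k i u v).
Proof.
move=> bk pk; elim: s => [|i s ih].
  rewrite (_ : (fun u v => _) = fun u v => 0 * 1).
    by apply: psdZ psd_cst1 => //; exact: bmeas_cst.
  by apply/funext => u; apply/funext => v; rewrite big_nil mul0r.
rewrite (_ : (fun u v => _) = fun u v => k i u v + \sum_(j <- s) k j u v).
  by apply: psdD => //; exact: bmeas_sum.
by apply/funext => u; apply/funext => v; rewrite big_cons.
Qed.

Lemma kop_cvg (k_ : nat -> T -> T -> R) (f_ : nat -> T -> R) k f (C D : R) u :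
  (forall n, bkernel (k_ n)) -> (forall n, bmeas (f_ n)) ->
  (forall n u v, `|k_ n u v| <= C) -> (forall n x, `|f_ n x| <= D) ->
  (forall v, (fun n => k_ n u v) @ \oo --> k u v) ->
  (forall x, (fun n => f_ n x) @ \oo --> f x) ->
  (fun n => kop (k_ n) (f_ n) u) @ \oo --> kop k f u.
Proof.
move=> bk bf kC fD kc fc; apply: (@Rint_dominated _ _ _ mu _ _ (C * D)).
- by move=> n; apply: measurable_funM; [case: (bkernel_l u (bk n))|case: (bf n)].
- by move=> n x; rewrite normrM ler_pM.
- by move=> x; apply: cvgM.
Qed.

Lemma ip_cvg (f_ g_ : nat -> T -> R) f g (C D : R) :
  (forall n, bmeas (f_ n)) -> (forall n, bmeas (g_ n)) ->
  (forall n x, `|f_ n x| <= C) -> (forall n x, `|g_ n x| <= D) ->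
  (forall x, (fun n => f_ n x) @ \oo --> f x) ->
  (forall x, (fun n => g_ n x) @ \oo --> g x) ->
  (fun n => iprod (f_ n) (g_ n)) @ \oo --> iprod f g.
Proof.
move=> bf bg fC gD fc gc; apply: (@Rint_dominated _ _ _ mu _ _ (C * D)).
- by move=> n; apply: measurable_funM; [case: (bf n)|case: (bg n)].
- by move=> n x; rewrite normrM ler_pM.
- by move=> x; apply: cvgM.
Qed.

Lemma kop_norm_le k f (C D : R) u : bkernel k -> bmeas f ->
  (forall u v, `|k u v| <= C) -> (forall x, `|f x| <= D) ->
  `|kop k f u| <= C * D.
Proof.
move=> bk bf kC fD; apply: norm_Rint_le.
  by apply: bmeasM => //; exact: bkernel_l.
by move=> x; rewrite normrM ler_pM.
Qed.

Lemma psd_cvg (k_ : nat -> T -> T -> R) k (C : R) :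
  (forall n, bkernel (k_ n)) -> (forall n u v, `|k_ n u v| <= C) ->
  (forall u v, (fun n => k_ n u v) @ \oo --> k u v) ->
  (forall n, psd_kernel (k_ n)) -> psd_kernel k.
Proof.
move=> bk kC kc pk c u f bf.
have [mf [D fD]] := bf.
have kf x : (fun n => kop (k_ n) f x) @ \oo --> kop k f x.
  exact: (kop_cvg (f_ := fun=> f) bk (fun=> bf) kC (fun=> fD) _ (fun=> cvg_cst _)).
have q : (fun n => c ^+ 2 * k_ n u u + 2 * c * kop (k_ n) f u + iprod (kop (k_ n) f) f)
    @ \oo --> c ^+ 2 * k u u + 2 * c * kop k f u + iprod (kop k f) f.
  apply: cvgD; first by apply: cvgD; apply: cvgMl_tmp => //.
  apply: (ip_cvg (C := C * D) (g_ := fun=> f) _ (fun=> bf) _ (fun=> fD) kf (fun=> cvg_cst _)).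
    by move=> n; exact: bmeas_kop.
  by move=> n x; exact: kop_norm_le.
rewrite -(cvg_lim _ q)//; apply: limr_ge; first exact: cvgP q.
by apply: nearW => n; exact: pk.
Qed.

(** The squared norm of [e] is its eigenvalue [l]. For [l != 0], the form of the deflated kernel at
    [f] is then the minimum over [s] of the form of [k] at [f + s e]. *)
Lemma psd_deflate k e l : bkernel k -> (forall u v, k u v = k v u) ->
  psd_kernel k -> bmeas e -> (forall u, kop k e u = l * e u) -> iprod e e = l ->
  (l = 0 -> forall u, e u = 0) -> psd_kernel (fun u v => k u v - e u * e v).
Proof.
move=> bk sk pk be ke ee l0 c u f bf.
have bkf : bmeas (kop k f) by exact: bmeas_kop.
have -> : kop (fun u v => k u v - e u * e v) f = fun x => kop k f x + - iprod e f * e x.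
  apply/funext => x; rewrite /kop /iprod -RintN; last exact: bmeasM.
  rewrite -RintZr; last by apply/bmeasN/bmeasM.
  rewrite -RintD; [|by apply: bmeasM => //; exact: bkernel_l|].
    by apply: eq_Rintegral => v _; ring.
  by apply: bmeasM; [apply/bmeasN/bmeasM|exact: bmeas_cst].
rewrite ipDl ?ipZl//; last exact: bmeasZ.
have [le0|ln0] := eqVneq l 0.
  have := pk c u f bf; congr (_ <= _); rewrite (l0 le0 u) (_ : iprod e f = 0); first by ring.
  by apply: ip_eq0 => //; rewrite ee.
(* The minimizer: [s] enters through [2 s l w + s^2 l^2] with [w = c * e u + iprod e f], whose
   minimum is [- w^2]. *)
pose s := - ((c * e u + iprod e f) / l).
have := pk c u (fun x => f x + s * e x) (bmeasD bf (bmeasZ s be)).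
rewrite (_ : kop k _ = fun x => kop k f x + (s * l) * e x); last first.
  by apply/funext => x; rewrite kopD ?kopZ ?ke//; [ring|exact: bmeasZ].
rewrite ipDl//; [|exact: bmeasZ|by apply: bmeasD => //; exact: bmeasZ].
rewrite !ipDr//; try exact: bmeasZ.
rewrite !ipZl//; last exact: bmeasZ.
rewrite !ipZr// ee (kop_sym bk sk bf be) (_ : iprod f (kop k e) = l * iprod e f); last first.
  rewrite (_ : kop k e = fun x => l * e x); last exact/funext.
  by rewrite ipZr// ipC.
by congr (_ <= _); rewrite /s; field.
Qed.

End kernel_operator.

(** * Power iteration *)

Section top_eigenfunction.
Context d (T : measurableType d) (R : realType) (mu : probability T R).
Variable k : T -> T -> R.
Hypotheses (bk : bkernel k) (sk : forall u v, k u v = k v u).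
Hypothesis pk : psd_kernel mu k.
Implicit Types f g : T -> R.
Local Notation ip := (iprod mu).
Local Notation A := (kop mu k).
Local Notation N f := (ip f f).

Let bA f : bmeas f -> bmeas (A f). Proof. exact: bmeas_kop. Qed.

Let bAn f j : bmeas f -> bmeas (iter j A f).
Proof. by move=> bf; elim: j => // j; rewrite iterS; exact: bA. Qed.

Let kb u : bmeas (k u). Proof. exact: bkernel_l. Qed.

Let ip_iter f g i j : bmeas f -> bmeas g ->
  ip (iter i A f) (iter j A g) = ip f (iter (i + j) A g).
Proof.
move=> bf bg; elim: i j => [//|i ih] j.
by rewrite iterS kop_sym// ?ih -?iterS ?addSnnS//; exact: bAn.
Qed.

Let ZA c f : bmeas f -> A (fun x => c * f x) = fun x => c * A f x.
Proof. by move=> bf; apply/funext => x; rewrite kopZ. Qed.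

Let DA f g : bmeas f -> bmeas g ->
  A (fun x => f x + g x) = fun x => A f x + A g x.
Proof. by move=> bf bg; apply/funext => x; rewrite kopD. Qed.

Let DAn j f g : bmeas f -> bmeas g ->
  iter j A (fun x => f x + g x) = fun x => iter j A f x + iter j A g x.
Proof. by move=> bf bg; elim: j => // j; rewrite !iterS => ->; rewrite DA//; exact: bAn. Qed.

Let C : R := sval (cid bk.2).
Let kC u v : `|k u v| <= C.
Proof. exact: (svalP (cid bk.2) (u, v)). Qed.
Let C0 : 0 <= C. Proof. exact: le_trans (kC point point). Qed.

Let A_le f u : bmeas f -> A f u ^+ 2 <= C ^+ 2 * N f.
Proof.
move=> bf; apply: le_trans (kop_CauchySchwarz mu u bk bf) _.
by apply: ler_wpM2r; [exact: ip_ge0|exact: ip_norm_le].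
Qed.

Let NA_le f : bmeas f -> N (A f) <= C ^+ 2 * N f.
Proof.
move=> bf; rewrite -[leRHS](Rint_cst mu); apply: le_Rint.
- by apply: bmeasM; exact: bA.
- exact: bmeas_cst.
- by move=> x; rewrite -expr2; exact: A_le.
Qed.

Let S : set R := [set N (A f) | f in [set f | bmeas f /\ N f <= 1]].

Let S_sup : has_sup S.
Proof.
split.
  exists (N (A (fun=> 0))), (fun=> 0) => //; split; first exact: bmeas_cst.
  by rewrite /iprod; under eq_Rintegral do rewrite mulr0; rewrite Rint_cst.
exists (C ^+ 2) => _ [f [bf Nf] <-]; apply: le_trans (NA_le bf) _.
by rewrite ler_piMr// sqr_ge0.
Qed.

(** The square of the operator norm of [A]; its root turns out to be the eigenvalue sought. *)
Let rho := sup S.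

Let NA_rho f : bmeas f -> N (A f) <= rho * N f.
Proof.
move=> bf; have [Nf0|Nf_neq0] := eqVneq (N f) 0.
  rewrite Nf0 mulr0; have := NA_le bf; by rewrite Nf0 mulr0.
have Nf0 : 0 < N f by rewrite lt_neqAle eq_sym Nf_neq0 ip_ge0.
pose s := (Num.sqrt (N f))^-1.
have ss : s * s = (N f)^-1 by rewrite /s -expr2 exprVn sqr_sqrtr// ltW.
have : S ((N f)^-1 * N (A f)).
  exists (fun x => s * f x).
    split; first exact: bmeasZ.
    by rewrite ipZl ?ipZr// ?mulrA ?ss ?mulVf//; exact: bmeasZ.
  by rewrite ZA// ipZl ?ipZr// ?mulrA ?ss//; try (apply: bmeasZ); exact: bA.
move/(ub_le_sup S_sup.2); rewrite -/rho mulrC ler_pdivrMr//.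
Qed.

(** The value of [A (k w)] at [w] is [N (k w)]. If [A] had norm zero, [k w] would have zero energy
    and this value would vanish by [psd_kop_eq0]. *)
Let rho_gt0 w : 0 < N (k w) -> 0 < rho.
Proof.
move=> w0; rewrite ltNge; apply/negP => rho0.
have N0 : N (A (k w)) = 0.
  apply/eqP; rewrite eq_le ip_ge0 andbT.
  apply: le_trans (NA_rho (kb w)) _; apply: mulr_le0_ge0 => //; exact: ip_ge0.
have := psd_kop_eq0 w pk (kb w) (ip_eq0 (bA (kb w)) (kb w) N0).
by move=> Nk; have {}Nk : N (k w) = 0 := Nk; rewrite Nk ltxx in w0.
Qed.

Let NAn_nonincr f : bmeas f -> 0 < rho ->
  {homo (fun j => N (iter j A f) / rho ^+ j) : m n / (m <= n)%N >-> n <= m}.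
Proof.
move=> bf r0; apply/nonincreasing_seqP => j.
rewrite iterS exprS invfM mulrA ler_pM2r ?invr_gt0 ?exprn_gt0//.
by rewrite ler_pdivrMr// mulrC NA_rho//; exact: bAn.
Qed.

Let NAn_ge0 f j : bmeas f -> 0 < rho -> 0 <= N (iter j A f) / rho ^+ j.
Proof. by move=> bf r0; rewrite divr_ge0 ?ip_ge0// exprn_ge0// ltW. Qed.

Let NAn_cvg f : bmeas f -> 0 < rho ->
  cvgn (fun j => N (iter j A f) / rho ^+ j).
Proof.
move=> bf r0; apply: nonincreasing_is_cvgn; first exact: NAn_nonincr.
by exists 0 => _ [j _ <-]; exact: NAn_ge0.
Qed.

(* By polarization this is a combination of three sequences [N (A^j _) / rho^j],
   which are nonincreasing. *)
Let ipAn_cvg f g : bmeas f -> bmeas g -> 0 < rho ->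
  cvgn (fun j => ip f (iter j.*2 A g) / rho ^+ j).
Proof.
move=> bf bg r0.
have bfg : bmeas (fun x => f x + g x) by exact: bmeasD.
have /cvg_ex[x cx] := NAn_cvg bfg r0.
have /cvg_ex[y cy] := NAn_cvg bf r0.
have /cvg_ex[z cz] := NAn_cvg bg r0.
apply/cvg_ex; exists (2^-1 * (x - y - z)).
rewrite (_ : (fun j => _) = fun j => 2^-1 *
    (N (iter j A (fun x => f x + g x)) / rho ^+ j - N (iter j A f) / rho ^+ j -
     N (iter j A g) / rho ^+ j)).
  by apply: cvgMl_tmp; apply: cvgB => //; exact: cvgB.
apply/funext => j /=.
rewrite -addnn -!ip_iter// DAn// ipDl ?ipDr//; try exact: bAn; last first.
  by apply: bmeasD; exact: bAn.
rewrite (ipC _ (iter j A g)); field.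
by rewrite gt_eqF// exprn_gt0.
Qed.

(* Log-convexity of [j |-> N (A^j f)]. *)
Let NA_pow f j : bmeas f -> N f <= 1 -> N (A f) ^+ j.+1 <= N (iter j.+1 A f).
Proof.
move=> bf Nf.
(* By Cauchy-Schwarz the ratios of successive terms do not decrease, and the first ratio is at least
   [N (A f)] because [N f <= 1]. *)
have step i : N (A f) * N (iter i A f) <= N (iter i.+1 A f).
  elim: i => [|i ih]; first by rewrite /= ler_piMr// ip_ge0.
  have ci : N (iter i.+1 A f) ^+ 2 <= N (iter i A f) * N (iter i.+2 A f).
    have := ip_CauchySchwarz mu (bAn i bf) (bAn i.+2 bf).
    by rewrite ip_iter// addnS -addSn -ip_iter.
  have [Ni0|Ni_neq0] := eqVneq (N (iter i A f)) 0.
    have -> : N (iter i.+1 A f) = 0.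
      apply/eqP; rewrite eq_le ip_ge0 andbT.
      by apply: le_trans (NA_le (bAn i bf)) _; rewrite Ni0 mulr0.
    by rewrite mulr0 ip_ge0.
  have Ni0 : 0 < N (iter i A f) by rewrite lt_neqAle eq_sym Ni_neq0 ip_ge0.
  rewrite -(ler_pM2l Ni0); apply: le_trans ci.
  by rewrite expr2 mulrA ler_wpM2r ?ip_ge0// mulrC.
elim: j => [|j ih]; first by rewrite expr1.
rewrite exprS; apply: le_trans (step j.+1).
by rewrite ler_wpM2l// ip_ge0.
Qed.

(** This is the kernel of [A^(j+1)]. Its joint measurability, by integration over a third variable,
    is what allows [a j] to be integrated over [w]. *)
Let bker_iter j : bkernel (fun w v => iter j A (k w) v).
Proof.
elim: j => [//|j ih].
apply: (@bmeas_Rint _ _ (T * T)%type T R (mu \x mu)%E mu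
  (fun z => k z.1.2 z.2 * iter j A (k z.1.1) z.2)).
apply: bmeasM.
  apply: (bmeas_comp (g := fun z : (T * T) * T => (z.1.2, z.2)) _ bk).
  apply: measurable_fun_pair => //; apply: measurableT_comp => //.
apply: (bmeas_comp (g := fun z : (T * T) * T => (z.1.1, z.2)) _ ih).
by apply: measurable_fun_pair => //; apply: measurableT_comp.
Qed.

Let a j w := N (iter j A (k w)).

Let ba j : bmeas (a j).
Proof.
apply: (@bmeas_Rint _ _ T T R mu mu
  (fun z => iter j A (k z.1) z.2 * iter j A (k z.1) z.2)).
by apply: bmeasM; exact: bker_iter.
Qed.

(** Since [A^(j+1) f] at [u] is the inner product of [A^j (k u)] with [f], its square is at most
    [a j u] when [N f <= 1]. Integrating over [u] bounds [N (A^(j+1) f)], which dominates the power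
    of [N (A f)] by [NA_pow]. *)
Let rho_le_trace j : 0 < rho -> rho ^+ j.+1 <= \int[mu]_w a j w.
Proof.
move=> r0; set I := \int[mu]_w _.
have I0 : 0 <= I by apply: Rintegral_ge0 => w _; exact: ip_ge0.
have IS x : S x -> x ^+ j.+1 <= I.
  move=> [f [bf Nf] <-]; apply: le_trans (NA_pow j bf Nf) _.
  apply: le_Rint => [||u]; [by apply: bmeasM; exact: bAn|exact: ba|].
  have -> : iter j.+1 A f u = ip (iter j A (k u)) f.
    by rewrite -[f in RHS]/(iter 0 A f) ip_iter// addn0.
  rewrite -expr2; apply: le_trans (ip_CauchySchwarz mu (bAn j (kb u)) bf) _.
  by rewrite ler_piMr// ip_ge0.
(* Taking roots makes this a bound on every element of [S], hence on the supremum. *)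
have : rho <= I `^ (j.+1%:R^-1).
  apply: ge_sup; first exact: S_sup.1.
  move=> x Sx; have x0 : 0 <= x by case: Sx => f _ <-; exact: ip_ge0.
  have -> : x = (x ^+ j.+1) `^ (j.+1%:R^-1).
    by rewrite -powR_mulrn// -powRrM mulfV ?powRr1// pnatr_eq0.
  by apply: ge0_ler_powR; rewrite ?nnegrE ?invr_ge0 ?exprn_ge0//; exact: IS.
move=> h; have -> : I = (I `^ (j.+1%:R^-1)) ^+ j.+1.
  by rewrite -powR_mulrn ?powR_ge0// -powRrM mulVf ?powRr1// pnatr_eq0.
by apply: lerXn2r; rewrite ?nnegrE ?powR_ge0// ltW.
Qed.

(** Spectrally, [rho] times the diagonal of the projection onto the top eigenspace. *)
Let alpha w : R := limn (fun j => a j w / rho ^+ j).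

Let alpha_cvg w : 0 < rho -> (fun j => a j w / rho ^+ j) @ \oo --> alpha w.
Proof. by move=> r0; exact: NAn_cvg. Qed.

(* [\int a j] is the squared Hilbert-Schmidt norm of [A^(j+1)], hence at least
   [rho^(j+1)]. *)
Let alpha_gt0 : 0 < rho -> exists w, 0 < alpha w.
Proof.
move=> r0; apply: contrapT => /forallNP h.
have b j w : `|a j w / rho ^+ j| <= C ^+ 2.
  rewrite ger0_norm; last exact: NAn_ge0.
  apply: le_trans (NAn_nonincr (kb w) r0 (leq0n j)) _.
  by rewrite expr0 divr1; exact: (ip_norm_le mu (kb w) (kC w)).
have ma j : measurable_fun setT (fun w => a j w / rho ^+ j).
  by apply: measurable_funM => //; case: (ba j).
have := Rint_dominated (mu := mu) ma b (fun w => @alpha_cvg w r0).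
(* Divided by [rho^j], the trace bound reads [rho] at every stage, and dominated convergence carries
   it to the limit. *)
move=> c; have : rho <= \int[mu]_w alpha w.
  rewrite -(cvg_lim _ c)//; apply: limr_ge; first exact: cvgP c.
  apply: nearW => j; rewrite RintZr; last exact: ba.
  by rewrite ler_pdivlMr ?exprn_gt0// -exprS rho_le_trace.
apply/negP; rewrite -ltNge; apply: (le_lt_trans _ r0).
have -> : 0 = \int[mu]_w (0 : R) by rewrite Rint_cst.
apply: le_Rint; [exact: bmeas_cvg ma b (fun w => @alpha_cvg w r0)|exact: bmeas_cst|].
by move=> w; rewrite leNgt; apply/negP; exact: h.
Qed.

(* [A^(2j+1) (k w) / rho^j] converges pointwise to some [H] with
   [A^2 H = rho H] and [N H = rho * alpha w]. *)
Lemma top_eigenfunction w0 : 0 < N (k w0) -> exists (r : R) (f : T -> R),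
  [/\ 0 < r, bmeas f, forall u, A f u = r * f u & 0 < N f].
Proof.
move=> /rho_gt0 r0; have [w aw] := alpha_gt0 r0.
pose h j u := A (iter j.*2 A (k w)) u / rho ^+ j.
have hE j : h j = fun u => (rho ^+ j)^-1 * iter j.*2.+1 A (k w) u.
  by apply/funext => u; rewrite /h mulrC iterS.
have bh j : bmeas (h j) by rewrite hE; apply: bmeasZ; exact: bAn.
have hC j u : `|h j u| <= C ^+ 2.
  rewrite -ler_sqr ?nnegrE ?sqr_ge0// real_normK ?num_real// /h expr_div_n -exprM [leRHS]expr2.
  rewrite muln2 ler_pdivrMr ?exprn_gt0//.
  apply: le_trans (A_le u (bAn _ (kb w))) _.
  rewrite -[leRHS]mulrA ler_wpM2l ?sqr_ge0// -ler_pdivrMr ?exprn_gt0//.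
  apply: le_trans (NAn_nonincr (kb w) r0 (leq0n _)) _.
  by rewrite expr0 divr1; exact: (ip_norm_le mu (kb w) (kC w)).
pose H (u : T) : R := limn (h^~ u).
(* [A f u] is [ip (k u) f], so the polarized sequence converges at each point [u]. *)
have hH u : h^~ u @ \oo --> H u by exact: (ipAn_cvg (kb u) (kb w) r0).
have bH : bmeas H by apply: (bmeas_cvg (F := h)) hC hH => j; case: (bh j).
have Ah (f_ : nat -> T -> R) (f : T -> R) (D : R) :
    (forall n, bmeas (f_ n)) -> (forall n x, `|f_ n x| <= D) ->
    (forall x, (fun n => f_ n x) @ \oo --> f x) ->
    forall u, (fun n => A (f_ n) u) @ \oo --> A f u.
  move=> bf fD fc u.
  apply: (@kop_cvg _ _ _ mu (fun=> k) f_ k f C D u) => // v; exact: cvg_cst.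
have AAH u : A (A H) u = rho * H u.
  have c1 := Ah _ _ _ bh hC hH.
  have c2 := Ah _ _ (C * C ^+ 2) (fun n => bA (bh n))
    (fun n x => kop_norm_le mu x bk (bh n) kC (hC n)) c1 u.
  have c3 : (fun j => rho * h j.+1 u) @ \oo --> rho * H u.
    by apply: cvgMl_tmp; have := hH u; rewrite -(cvg_shiftS (h^~ u)).
  have e : (fun j => A (A (h j)) u) = fun j => rho * h j.+1 u.
    apply/funext => j; rewrite !hE ZA; last exact: bAn.
    rewrite ZA; last exact: (bAn j.*2.+2).
    by rewrite doubleS !iterS exprS invfM !mulrA mulfV ?mul1r// gt_eqF.
  by move: c2; rewrite e => c2; rewrite -(cvg_lim _ c2)// (cvg_lim _ c3).
have NH : 0 < N H.
  have c1 : (fun j => N (h j)) @ \oo --> N H by exact: (ip_cvg (mu := mu) bh bh hC hC hH hH).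
  have c2 : (fun j => rho * (a j.*2.+1 w / rho ^+ j.*2.+1)) @ \oo --> rho * alpha w.
    apply: cvgMl_tmp; apply: (cvg_comp (fun j => j.*2.+1) _ _ (@alpha_cvg w r0)).
    apply/cvgnyPge => n; near=> m; apply: leqW; rewrite -addnn.
    by apply: leq_trans (leq_addr _ _); near: m; exists n.
  have e : (fun j => N (h j)) = fun j => rho * (a j.*2.+1 w / rho ^+ j.*2.+1).
    apply/funext => j; have bj := bAn j.*2.+1 (kb w).
    rewrite hE ipZl//; last exact: bmeasZ.
    rewrite ipZr//.
    rewrite -/(a _ w) exprS -addnn exprD; field.
    by rewrite !gt_eqF// exprn_gt0.
  move: c1; rewrite e => c1; rewrite -(cvg_lim _ c1)// (cvg_lim _ c2)//.
  exact: mulr_gt0.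
pose r := Num.sqrt rho.
have rr : r * r = rho by rewrite -expr2 sqr_sqrtr// ltW.
have r_gt0 : 0 < r by rewrite sqrtr_gt0.
(* The factorization [A^2 - r^2 = (A - r) (A + r)] makes [F = (A + r) H] an eigenfunction for [r].
   It is nonzero because [ip F H] is at least [r * N H], by positivity of [A]. *)
pose F u := A H u + r * H u.
have bF : bmeas F by apply: bmeasD; [exact: bA|exact: bmeasZ].
exists r, F; split => //.
  move=> u; rewrite /F DA; [|exact: bA|exact: bmeasZ].
  by rewrite ZA// AAH -rr; ring.
have FH : 0 < ip F H.
  rewrite ipDl ?ipZl//; [|exact: bA|exact: bmeasZ].
  by rewrite ltr_wpDl ?mulr_gt0//; exact: psd_ip_ge0.
rewrite lt_neqAle ip_ge0 andbT; apply/eqP => /esym NF0.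
by rewrite (ip_eq0 bF bH NF0) ltxx in FH.
Unshelve. all: by end_near. Qed.

End top_eigenfunction.

(** * Mercer's theorem *)

Section mercer.
Context d (T : measurableType d) (R : realType) (mu : probability T R).
Variables (P : T -> T -> R) (e : nat -> T -> R) (lam : nat -> R).
Hypotheses (bP : bkernel P) (sP : forall u v, P u v = P v u).
Hypothesis pP : psd_kernel mu P.
Hypothesis be : forall i, bmeas (e i).
Hypothesis Pe : forall i u, kop mu P (e i) u = lam i * e i u.
Hypothesis ee : forall i j, iprod mu (e i) (e j) = lam i * (i == j)%:R.
Hypothesis e0 : forall i, lam i = 0 -> forall u, e i u = 0.
Hypothesis complete : forall r f, 0 < r -> bmeas f ->
  (forall u, kop mu P f u = r * f u) ->
  (forall i, iprod mu f (e i) = 0) -> iprod mu f f = 0.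

Definition mercer_sum n u v := \sum_(0 <= i < n) e i u * e i v.

Let C : R := sval (cid bP.2).
Let PC u v : `|P u v| <= C.
Proof. exact: (svalP (cid bP.2) (u, v)). Qed.
Let C0 : 0 <= C. Proof. exact: le_trans (PC point point). Qed.

Let Rn n u v := P u v - mercer_sum n u v.

Let b_sum n : bkernel (mercer_sum n).
Proof. by apply: bmeas_sum => i; exact: bkernel_prod. Qed.

Let bRn n : bkernel (Rn n). Proof. exact: (bmeasB bP (b_sum n)). Qed.

Let sRn n u v : Rn n u v = Rn n v u.
Proof. by congr (_ - _); [exact: sP|apply: eq_bigr => i _; rewrite mulrC]. Qed.

Let kopRn n f u : bmeas f ->
  kop mu (Rn n) f u = kop mu P f u - \sum_(0 <= i < n) e i u * iprod mu (e i) f.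
Proof.
move=> bf.
have E i : e i u * iprod mu (e i) f = \int[mu]_v (e i u * (e i v * f v)).
  by rewrite RintZl//; exact: bmeasM.
under eq_bigr do rewrite E.
rewrite -Rint_sum; last by move=> i; apply/bmeasZ/bmeasM.
rewrite /kop -RintB; first last.
- by apply: bmeas_sum => i; apply/bmeasZ/bmeasM.
- by apply: bmeasM => //; exact: bkernel_l.
apply: eq_Rintegral => v _; rewrite /Rn mulrBl mulr_suml; congr (_ - _).
by apply: eq_bigr => i _; rewrite mulrA.
Qed.

Let kopRn_e n j u : kop mu (Rn n) (e j) u = if (j < n)%N then 0 else lam j * e j u.
Proof.
rewrite kopRn// Pe; case: ifPn => jn.
  rewrite big_mkord (bigD1 (Ordinal jn))//= big1 => [|i ij].
    by rewrite ee eqxx mulr1 addr0 mulrC subrr.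
  rewrite ee (_ : (_ == _) = false) ?mulr0//.
  by apply/negbTE; apply: contra ij => /eqP ij; exact/eqP/val_inj.
rewrite big_nat_cond big1 ?subr0// => i /andP[/andP[_ ni] _].
by rewrite ee (_ : (_ == _) = false) ?mulr0//; apply/negbTE; apply: contra jn => /eqP <-.
Qed.

(** By orthogonality [e n] is still an eigenfunction of the residual [Rn n], for the eigenvalue
    [lam n], so deflation applies at each step. *)
Let pRn n : psd_kernel mu (Rn n).
Proof.
elim: n => [|n ih].
  have -> : Rn 0 = P; last exact: pP.
  by apply/funext => u; apply/funext => v; rewrite /Rn /mercer_sum big_nil subr0.
have -> : Rn n.+1 = fun u v => Rn n u v - e n u * e n v.
  apply/funext => u; apply/funext => v.
  by rewrite /Rn /mercer_sum big_nat_recr//= opprD addrA.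
apply: (@psd_deflate _ _ _ mu _ _ (lam n)) => //.
- by move=> u; rewrite kopRn_e ltnn.
- by rewrite ee eqxx mulr1.
- exact: e0.
Qed.

(** Testing the residual on the Dirac mass at [u] gives the inequality at every point; all the later
    uniform bounds come from it. *)
Lemma mercer_bessel n u : mercer_sum n u u <= P u u.
Proof. by have := psd_diag u (pRn n); rewrite subr_ge0. Qed.

Lemma mercer_sum_ge0 n u : 0 <= mercer_sum n u u.
Proof. by apply: sumr_ge0 => i _; rewrite -expr2 sqr_ge0. Qed.

Let sum_le_C n u : mercer_sum n u u <= C.
Proof. exact: le_trans (mercer_bessel n u) (le_trans (ler_norm _) (PC u u)). Qed.

(* Weighted AM-GM: [2 |x y| <= x^2 / eta + eta y^2] *)
Let prod_sum_le m n u v (eta : R) : 0 < eta ->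
  \sum_(m <= i < n) `|e i u * e i v| <=
  (eta^-1 * \sum_(m <= i < n) e i u * e i u +
   eta * \sum_(m <= i < n) e i v * e i v) / 2.
Proof.
move=> eta0; rewrite !mulr_sumr -big_split mulr_suml; apply: ler_sum => i _ /=.
rewrite -subr_ge0 normrM.
rewrite -[e i u * e i u]expr2 -[e i v * e i v]expr2.
rewrite -(real_normK (num_real (e i u))) -(real_normK (num_real (e i v))).
set x := `|e i u|; set y := `|e i v|.
rewrite (_ : _ - _ = eta^-1 / 2 * (x - eta * y) ^+ 2).
  by rewrite mulr_ge0 ?sqr_ge0// divr_ge0// invr_ge0 ltW.
by field; rewrite gt_eqF.
Qed.

Let normed_sum_le n u v : \sum_(0 <= i < n) `|e i u * e i v| <= C.
Proof.
apply: le_trans (prod_sum_le 0 n u v ltr01) _.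
rewrite invr1 !mul1r ler_pdivrMr// mulr_natr mulr2n.
by apply: lerD; exact: sum_le_C.
Qed.

Lemma mercer_is_cvg u v : cvgn (fun n => mercer_sum n u v).
Proof.
apply: (@normed_cvg _ R (fun i => e i u * e i v)).
apply: nondecreasing_is_cvgn; first by apply: nondecreasing_series => n _ _ /=; exact: normr_ge0.
by exists C => _ [n _ <-]; exact: normed_sum_le.
Qed.

Definition mercer_lim u v : R := limn (fun n => mercer_sum n u v).

Lemma mercer_cvg u v : (fun n => mercer_sum n u v) @ \oo --> mercer_lim u v.
Proof. exact: mercer_is_cvg. Qed.

Let K u v := P u v - mercer_lim u v.

Let Rn_cvg u v : (fun n => Rn n u v) @ \oo --> K u v.
Proof. by apply: cvgB; [exact: cvg_cst|exact: mercer_cvg]. Qed.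

Let RnC n u v : `|Rn n u v| <= C + C.
Proof.
apply: le_trans (ler_normB _ _) _; apply: lerD => //.
exact: le_trans (ler_norm_sum _ _ _) (normed_sum_le _ _ _).
Qed.

Let bK : bkernel K.
Proof.
apply: (@bmeas_cvg _ _ R (fun n z => Rn n z.1 z.2) _ (C + C)) => //.
by move=> n; case: (bRn n).
Qed.

Let sK u v : K u v = K v u.
Proof. by rewrite /K sP /mercer_lim; congr (_ - limn _); apply/funext => n;
  apply: eq_bigr => i _; rewrite mulrC. Qed.

Let pK : psd_kernel mu K.
Proof. exact: psd_cvg bRn RnC Rn_cvg pRn. Qed.

Let kopRn_cvg f u : bmeas f -> (fun n => kop mu (Rn n) f u) @ \oo --> kop mu K f u.
Proof.
move=> bf; case: (bf) => _ [D fD].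
by apply: (kop_cvg (f_ := fun=> f) (C := C + C) (D := D)) => // x; exact: cvg_cst.
Qed.

Let kopK_e j u : kop mu K (e j) u = 0.
Proof.
rewrite -(cvg_lim _ (@kopRn_cvg _ u (be j)))//.
apply/cvg_lim => //; apply: cvg_near_cst; exists j.+1 => // n /= jn.
by rewrite kopRn_e jn.
Qed.

(** An eigenfunction [f] of the residual [K] with eigenvalue [r > 0] is orthogonal to each [e i], by
    symmetry of [K] and [K (e i) = 0]. On such an [f] the operators of [K] and [P] agree, which
    contradicts completeness. *)
Lemma mercer_ae w : {ae mu, forall v, P w v = mercer_lim w v}.
Proof.
suff K0 : iprod mu (K w) (K w) = 0.
  have bKw := bkernel_l w bK.
  have := Rint_eq0_ae (bmeasM bKw bKw) (fun v => _) K0.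
  move=> /(_ ltac:(by move=> v; rewrite -expr2 sqr_ge0)).
  by apply: ae_imp => v /eqP; rewrite mulf_eq0 orbb subr_eq0 => /eqP.
apply/eqP; apply: contraT; rewrite neq_lt ltNge ip_ge0/= => w0.
have [r [f [r0 bf Kf Nf]]] := top_eigenfunction bK sK pK w0.
have fe i : iprod mu f (e i) = 0.
  suff : r * iprod mu f (e i) = 0 by move/eqP; rewrite mulf_eq0 gt_eqF//= => /eqP.
  rewrite -ipZl// -[LHS]/(iprod mu (fun x => r * f x) (e i)).
  rewrite (_ : (fun x => r * f x) = kop mu K f); last by apply/funext => x; rewrite Kf.
  rewrite kop_sym// (_ : kop mu K (e i) = fun=> 0); last by apply/funext => x; exact: kopK_e.
  by rewrite /iprod; under eq_Rintegral do rewrite mulr0; rewrite Rint_cst.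
have Pf u : kop mu P f u = r * f u.
  rewrite -Kf -(cvg_lim _ (@kopRn_cvg _ u bf))//; apply/esym/cvg_lim => //.
  apply: cvg_near_cst; apply: nearW => n; rewrite kopRn//.
  by rewrite big1 ?subr0// => i _; rewrite ipC fe mulr0.
by move: Nf; rewrite (complete r0 bf Pf fe) ltxx.
Qed.

(** Uniform in [v] for fixed [w]. The tail of the diagonal series at [w] is small while the one at
    [v] is only bounded by [C]. The weight [eta] balances the two: the first contributes at most
    [eps * eta / eta], the second at most [eta * C <= eps]. *)
Lemma mercer_tail w (eps : R) : 0 < eps ->
  exists n, forall v, `|mercer_lim w v - mercer_sum n w v| <= eps.
Proof.
move=> eps0; pose eta := eps / (C + 1).
have C1 : 0 < C + 1 by rewrite ltr_wpDl.
have eta0 : 0 < eta by rewrite divr_gt0.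
have nd : nondecreasing_seq (fun n => mercer_sum n w w).
  by apply: nondecreasing_series => n _ _; rewrite -expr2 sqr_ge0.
have [n nP] : exists n, mercer_lim w w - eps * eta < mercer_sum n w w.
  have : mercer_lim w w - eps * eta < mercer_lim w w by rewrite ltrBlDr ltrDl mulr_gt0.
  move=> /(cvgr_gt _ (@mercer_cvg w w))[n _ /(_ n (leqnn n))].
  by exists n.
exists n => v.
have h m : (n <= m)%N -> `|mercer_sum m w v - mercer_sum n w v| <= eps.
  move=> nm; rewrite /mercer_sum (big_cat_nat (n := n))//= addrAC subrr add0r.
  apply: le_trans (ler_norm_sum _ _ _) _.
  apply: le_trans (prod_sum_le n m w v eta0) _.
  rewrite ler_pdivrMr// mulr_natr mulr2n; apply: lerD.
    rewrite mulrC ler_pdivrMr//.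
    have -> : \sum_(n <= i < m) e i w * e i w = mercer_sum m w w - mercer_sum n w w.
      by rewrite /mercer_sum (big_cat_nat (n := n) (m := 0%N))//= addrAC subrr add0r.
    have le_lim := nondecreasing_cvgn_le nd (@mercer_is_cvg w w) m.
    rewrite lerBlDr; apply: (le_trans le_lim).
    by rewrite -lerBlDl ltW.
  rewrite /eta -mulrA ler_piMr ?(ltW eps0)// mulrC ler_pdivrMr// mul1r.
  apply: (@le_trans _ _ (mercer_sum m v v)).
    rewrite /mercer_sum [leRHS](big_cat_nat (n := n))//= lerDr.
    exact: mercer_sum_ge0.
  by apply: le_trans (sum_le_C m v) _; rewrite lerDl.
have c : (fun m => `|mercer_sum m w v - mercer_sum n w v|) @ \oo -->
    `|mercer_lim w v - mercer_sum n w v|.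
  by apply: cvg_norm; apply: cvgB; [exact: mercer_cvg|exact: cvg_cst].
rewrite -(cvg_lim _ c)//; apply: limr_le; first exact: cvgP c.
by exists n => // m /= nm; exact: h.
Qed.

End mercer.

(** * The power series of arcsin *)

Section arcsine_series.
Context {R : realType}.
Implicit Types (n : nat) (r s t x y : R).

(** Equal to [binom(2n, n) / 4^n], the coefficient of [x^(2n)] in [(1 - x^2)^(-1/2)]; termwise
    integration gives [arcsin_coef]. *)
Definition invsqrt_coef n : R := \prod_(i < n) (i.*2.+1%:R / i.*2.+2%:R).
Local Notation b := invsqrt_coef.

Definition invsqrt_poly n : {poly R} := \sum_(k < n) b k *: 'X^(k.*2).
Local Notation q := invsqrt_poly.

Definition arcsin_coef n : R := b n / n.*2.+1%:R.

Definition arcsin_poly n : {poly R} := \sum_(k < n) arcsin_coef k *: 'X^(k.*2.+1).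
Local Notation p := arcsin_poly.

Let b_ge0 n : 0 <= b n.
Proof. by apply: prodr_ge0 => i _; rewrite divr_ge0. Qed.

Let b_le1 n : b n <= 1.
Proof.
rewrite -[leRHS](expr1n _ n) -[n in leRHS]card_ord -prodr_const.
apply: ler_prod => i _; rewrite divr_ge0//= ler_pdivrMr ?ltr0n// mul1r ler_nat.
exact: leqnSn.
Qed.

Let bS n : n.+1.*2%:R * b n.+1 = n.*2.+1%:R * b n.
Proof.
rewrite /invsqrt_coef big_ord_recr/= doubleS mulrCA.
by rewrite [_.+2%:R * _]mulrC divfK ?pnatr_eq0// mulrC.
Qed.

Lemma arcsin_coef_ge0 n : 0 <= arcsin_coef n.
Proof. by rewrite divr_ge0. Qed.

Lemma horner_arcsin_poly n x :
  (p n).[x] = \sum_(k < n) arcsin_coef k * x ^+ k.*2.+1.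
Proof. by rewrite horner_sum; apply: eq_bigr => i _; rewrite hornerZ hornerXn. Qed.

Let qE n x : (q n).[x] = \sum_(k < n) b k * x ^+ k.*2.
Proof. by rewrite horner_sum; apply: eq_bigr => i _; rewrite hornerZ hornerXn. Qed.

Let deriv_p n : (p n)^`() = q n.
Proof.
rewrite raddf_sum; apply: eq_bigr => i _ /=; rewrite derivZ derivXn/= -scaler_nat scalerA.
by rewrite /arcsin_coef divfK// pnatr_eq0.
Qed.

(* [q n] is a truncation of the series of [(1 - x^2)^(-1/2)], a solution of
   [(1 - x^2) y' = x y]. *)
Let q_ode n x : (1 - x ^+ 2) * (q n.+1)^`().[x] - x * (q n.+1).[x] =
  - (n.*2.+1%:R * b n * x ^+ n.*2.+1).
Proof.
elim: n => [|n ih].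
  rewrite /invsqrt_poly big_ord_recr big_ord0/= add0r expr0 derivZ derivC scaler0 horner0.
  by rewrite hornerZ hornerC expr1 double0; ring.
have -> : q n.+2 = q n.+1 + b n.+1 *: 'X^(n.+1.*2) by rewrite /invsqrt_poly big_ord_recr.
rewrite derivD hornerD hornerD mulrDr mulrDr opprD addrACA ih derivZ hornerZ hornerZ.
rewrite derivXn hornerMn !hornerXn -bS doubleS/= -[_ *+ _]mulr_natl.
rewrite -[n.*2.+3%:R]natr1 !exprS; ring.
Qed.

(** The error of the partial sum, written in [t = arcsin x]: in this variable it is smooth on the
    whole line, with derivative [1 - g n t]. *)
Let h n t := t - (p n.+1).[sin t].
Let g n t := (q n.+1).[sin t] * cos t.

Let derive_h n t : is_derive t 1 (h n) (1 - g n t).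
Proof.
have -> : h n = @id R - (horner (p n.+1) \o sin) by [].
by apply: is_derive_eq; rewrite deriv_p.
Qed.

(** This is [q_ode] at [sin t]: a single term survives the truncation. *)
Let derive_g n t : is_derive t 1 (g n) (- (n.*2.+1%:R * b n * sin t ^+ n.*2.+1)).
Proof.
have -> : g n = (horner (q n.+1) \o sin) * @cos R by [].
apply: is_derive_eq.
rewrite -q_ode/= -[1 in RHS](cos2Dsin2 t) /GRing.scale/=; ring.
Qed.

Let mvt (f df : R -> R) a c : (forall t, is_derive t 1 f (df t)) -> a <= c ->
  exists2 t, a <= t <= c & f c - f a = df t * (c - a).
Proof.
move=> fdf ac; apply: MVT_segment => //; apply: continuous_subspaceT => t.
by apply/differentiable_continuous/derivable1_diffP; case: (fdf t).
Qed.

Let p_odd n x : (p n).[- x] = - (p n).[x].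
Proof.
rewrite !horner_arcsin_poly -sumrN; apply: eq_bigr => i _.
by rewrite exprNn -signr_odd/= odd_double expr1 mulN1r mulrN.
Qed.

Let p_ge0 n x : 0 <= x -> 0 <= (p n).[x].
Proof.
move=> x0; rewrite horner_arcsin_poly; apply: sumr_ge0 => i _.
by rewrite mulr_ge0 ?arcsin_coef_ge0 ?exprn_ge0.
Qed.

Let ler_p n x y : 0 <= x -> x <= y -> (p n).[x] <= (p n).[y].
Proof.
move=> x0 xy; rewrite !horner_arcsin_poly; apply: ler_sum => i _.
by rewrite ler_wpM2l ?arcsin_coef_ge0// lerXn2r// nnegrE (le_trans x0).
Qed.

Let sin_ge0 t : 0 <= t <= pi / 2 -> 0 <= sin t :> R.
Proof.
move=> /andP[t0 tpi]; apply: sin_ge0_pi; rewrite t0/=; apply: le_trans tpi _.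
by rewrite ler_pdivrMr// ler_peMr ?pi_ge0// ler1n.
Qed.

Let g_le n t : 0 <= t <= pi / 2 -> 0 <= g n t <= 1.
Proof.
move=> t02; apply/andP; split.
  rewrite mulr_ge0// ?qE.
    by apply: sumr_ge0 => i _; rewrite mulr_ge0// exprn_ge0// sin_ge0.
  apply: cos_ge0_pihalf; move/andP: t02 => [t0 ->].
  by rewrite andbT (le_trans _ t0)// oppr_le0 divr_ge0 ?pi_ge0.
move/andP: t02 => [t0 t2].
have [c /andP[c0 ct]] := mvt (derive_g n) t0.
have -> : g n 0 = 1.
  rewrite /g sin0 cos0 mulr1 qE big_ord_recl/= big1 => [|i _].
    by rewrite /invsqrt_coef big_ord0 expr0 mulr1 addr0.
  by rewrite expr0n/= mulr0.
move=> e; rewrite -subr_le0 e subr0 mulNr oppr_le0 !mulr_ge0// exprn_ge0//.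
by apply: sin_ge0; rewrite c0 (le_trans ct).
Qed.

Let h0 n : h n 0 = 0.
Proof.
rewrite /h sin0 sub0r horner_arcsin_poly big1 ?oppr0// => i _.
by rewrite expr0n mulr0.
Qed.

Let h_ge0 n t : 0 <= t <= pi / 2 -> 0 <= h n t.
Proof.
move=> /andP[t0 t2].
have [c /andP[c0 ct]] := mvt (derive_h n) t0.
rewrite h0 !subr0 => ->; rewrite mulr_ge0// subr_ge0.
by have := @g_le n c; rewrite c0 (le_trans ct)// => /(_ isT)/andP[].
Qed.

(** Two mean value steps lead from [g'] to [g] and from [g] to [h]. Each costs a factor at most 2,
    since [pi / 2 < 2], and the coefficient [b n] is at most 1. *)
Let h_le n t : 0 <= t <= pi / 2 ->
  h n t <= 4 * (n.*2.+1%:R * sin t ^+ n.*2.+1).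
Proof.
move=> /andP[t0 t2]; have t_le2 : t <= 2 by apply: le_trans t2 (ltW (pihalf_lt2 R)).
have st : 0 <= sin t by apply: sin_ge0; rewrite t0.
have gc (c : R) : 0 <= c <= t -> 1 - g n c <= 2 * (n.*2.+1%:R * sin t ^+ n.*2.+1).
  move=> /andP[c0 ct].
  have [s /andP[s0 sc]] := mvt (derive_g n) c0.
  have g0 : g n 0 = 1.
    rewrite /g sin0 cos0 mulr1 qE big_ord_recl/= big1 => [|i _].
      by rewrite /invsqrt_coef big_ord0 expr0 mulr1 addr0.
    by rewrite expr0n/= mulr0.
  rewrite g0 subr0 => e.
  have -> : 1 - g n c = c * (n.*2.+1%:R * b n * sin s ^+ n.*2.+1).
    by rewrite -opprB e; ring.
  have ss : 0 <= sin s by apply: sin_ge0; rewrite s0 (le_trans (le_trans sc ct)).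
  have sst : sin s <= sin t.
    have ds (u : R) : is_derive u 1 (@sin R) (cos u) by exact: is_derive_sin.
    have st' : s <= t by exact: le_trans sc ct.
    have [v /andP[sv vt] e'] := mvt ds st'.
    rewrite -subr_ge0 e' mulr_ge0 ?subr_ge0//; apply: cos_ge0_pihalf.
    rewrite (le_trans vt t2) andbT (le_trans _ (le_trans s0 sv))//.
    by rewrite oppr_le0 divr_ge0 ?pi_ge0.
  apply: ler_pM => //; [by rewrite !mulr_ge0// exprn_ge0|exact: le_trans ct t_le2|].
  rewrite -mulrA ler_wpM2l// -[leRHS]mul1r ler_pM// ?exprn_ge0//.
  by rewrite lerXn2r// nnegrE.
have [c /andP[c0 ct]] := mvt (derive_h n) t0.
rewrite h0 !subr0 => ->; rewrite mulrC (_ : 4 = 2 * 2 :> R); last by ring.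
rewrite -mulrA; apply: ler_pM => //; last by apply: gc; rewrite c0.
by rewrite subr_ge0; have := @g_le n c; rewrite c0 (le_trans ct)// => /(_ isT)/andP[].
Qed.

(** Bernoulli's inequality for [r^-1] bounds [(2n+1) r^(n+1)] by [2 / dl]: half of the power absorbs
    the linear factor, the other half tends to 0. *)
Let cvg_nexp (r : R) : 0 <= r -> r < 1 ->
  (fun n => n.*2.+1%:R * r ^+ n.*2.+1) @ \oo --> 0.
Proof.
move=> r0 r1; have [->|rn0] := eqVneq r 0.
  rewrite (_ : (fun n => _) = fun=> 0); first exact: cvg_cst.
  by apply/funext => n; rewrite expr0n mulr0.
have {rn0}r0 : 0 < r by rewrite lt_neqAle eq_sym rn0.
pose dl := r^-1 - 1; have dl0 : 0 < dl by rewrite subr_gt0 invf_gt1.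
have ri : 1 <= r^-1 by rewrite -subr_ge0 ltW.
have bern n : n%:R * dl <= (r^-1) ^+ n.
  elim: n => [|n ih]; first by rewrite mul0r.
  have -> : n.+1%:R * dl = dl + n%:R * dl by rewrite -natr1 mulrDl mul1r addrC.
  have dle : dl <= dl * r^-1 ^+ n.
    by apply: ler_peMr; [exact: ltW|exact: exprn_ege1].
  by apply: le_trans (lerD dle ih) _; rewrite exprS /dl mulrBl mul1r subrK.
apply: (@squeeze_cvgr _ _ _ _ (fun=> 0) (fun n => 2 / dl * r ^+ n)); last 2 first.
- exact: cvg_cst.
- rewrite -[X in _ --> X](mulr0 (2 / dl)); apply: cvgMl_tmp.
  by apply: cvg_expr; rewrite gtr0_norm.
apply: nearW => n; rewrite mulr_ge0 ?exprn_ge0 ?(ltW r0)//=.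
rewrite -addnn -addSn exprD mulrA ler_wpM2r ?exprn_ge0 ?(ltW r0)//.
rewrite -[r in leLHS]invrK exprVn ler_pdivrMr ?exprn_gt0 ?invr_gt0//.
rewrite mulrAC ler_pdivlMr//; apply: le_trans (_ : 2 * (n.+1%:R * dl) <= _).
  by rewrite mulrA ler_wpM2r ?(ltW dl0)// -natrM ler_nat mul2n -addnn leq_add2l.
by rewrite ler_wpM2l.
Qed.

(** For [t >= 0] the partial sums lie between 0 and [t], and oddness gives the rest. This is the
    constant that dominates in the limits of kernels. *)
Lemma arcsin_poly_le n t : - (pi / 2) <= t <= pi / 2 ->
  `|(p n).[sin t]| <= pi / 2.
Proof.
have pos s : 0 <= s <= pi / 2 -> `|(p n).[sin s]| <= pi / 2.
  move=> s02; rewrite ger0_norm ?p_ge0 ?sin_ge0//.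
  case: n => [|n]; first by rewrite /arcsin_poly big_ord0 horner0 divr_ge0 ?pi_ge0.
  have := h_ge0 n s02; rewrite subr_ge0 => /le_trans; apply.
  by case/andP: s02.
move=> /andP[t1 t2]; have [t0|/ltW t0] := leP 0 t; first by apply: pos; rewrite t0.
by rewrite -[t]opprK sinN p_odd normrN; apply: pos; rewrite oppr_ge0 t0 lerNl.
Qed.

Lemma arcsin_poly_cvg t : - (pi / 2) <= t <= pi / 2 ->
  (fun n => (p n).[sin t]) @ \oo --> t.
Proof.
have lt s : 0 <= s -> s < pi / 2 -> (fun n => h n s) @ \oo --> 0.
  move=> s0 s2; have s02 : 0 <= s <= pi / 2 by rewrite s0 ltW.
  apply: (@squeeze_cvgr _ _ _ _ (fun=> 0)
    (fun n => 4 * (n.*2.+1%:R * sin s ^+ n.*2.+1))).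
  - by apply: nearW => n; rewrite h_ge0//= h_le.
  - exact: cvg_cst.
  - rewrite -[X in _ --> X](mulr0 4); apply: cvgMl_tmp; apply: cvg_nexp.
      exact: sin_ge0.
    rewrite -(sin_pihalf R) ltr_sin// in_itv/= ?lexx ?andbT.
      by rewrite (le_trans _ s0)/= ?(ltW s2)// oppr_le0 divr_ge0 ?pi_ge0.
    by rewrite ge0_cp ?divr_ge0 ?pi_ge0.
(* At [sin t = 1] the bound [h_le] is useless. As the coefficients are nonnegative, the partial sum
   at 1 is at least the one at [sin s], so [h n (pi / 2) <= h n s + (pi / 2 - s)] for [s] close to
   [pi / 2]. *)
have pih : (fun n => h n (pi / 2)) @ \oo --> 0.
  apply/cvgr0Pnorm_le => eps eps0.
  have pi2 : 0 < pi / 2 :> R by rewrite divr_gt0 ?pi_gt0.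
  pose s := Num.max 0 (pi / 2 - eps / 2).
  have s0 : 0 <= s by rewrite le_max lexx.
  have s2 : s < pi / 2 by rewrite gt_max pi2 gtrBl divr_gt0.
  have s3 : pi / 2 - s <= eps / 2 by rewrite lerBlDr -lerBlDl le_max lexx orbT.
  have : \forall n \near \oo, `|h n s| <= eps / 2.
    by move/cvgr0Pnorm_le : (lt s s0 s2); apply; rewrite divr_gt0.
  apply: filterS => n hn; rewrite ger0_norm; last by apply: h_ge0; rewrite (ltW pi2) lexx.
  have -> : eps = eps / 2 + eps / 2 by field.
  have := ler_norm (h n s) => hn'; have := le_trans hn' hn; rewrite /h => {}hn.
  have := ler_p n.+1 (x := sin s) (y := sin (pi / 2)).
  rewrite sin_pihalf sin_ge0 ?s0 ?(ltW s2)// sin_le1 => /(_ erefl erefl).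
  by move: hn s3; lra.
have pos s : 0 <= s <= pi / 2 -> (fun n => (p n).[sin s]) @ \oo --> s.
  move=> /andP[s0]; rewrite le_eqVlt => s2.
  have hs : (fun n => h n s) @ \oo --> 0.
    by case/predU1P : s2 => [->|s2] //; exact: lt.
  rewrite -cvg_shiftS (_ : (fun n => _) = fun n => s - h n s); last first.
    by apply/funext => n; rewrite /h opprB addrC subrK.
  by have := cvgB (cvg_cst s) hs; rewrite subr0; apply.
move=> /andP[t1 t2]; have [t0|/ltW t0] := leP 0 t; first by apply: pos; rewrite t0.
rewrite -[t]opprK sinN (_ : (fun n => _) = fun n => - (p n).[sin (- t)]).
  by apply: cvgN; apply: pos; rewrite oppr_ge0 t0 lerNl.
by apply/funext => n; rewrite p_odd.
Qed.

End arcsine_series.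

(** * Orthogonal invariance of Lebesgue measure *)

Section lebesgue_tuple_invariance.
Context {R : realType}.
Local Notation RT := (measurableTypeR R).
Local Notation leb := (@lebesgue_tuple R _).

Lemma lebesgue_measure_shift (a : R) (A : set RT) : measurable A ->
  lebesgue_measure [set x : RT | A (x + a)] = lebesgue_measure A.
Proof.
have ms : measurable_fun setT (fun x : RT => x + a : RT).
  by apply: measurable_funD => //; exact: measurable_cst.
pose nu : {measure set RT -> \bar R} :=
  measure_function_pushforward__canonical__measure_function_Measure
    (@lebesgue_measure R) ms.
move=> mA; rewrite (_ : lebesgue_measure [set x | _] = nu A)//.
apply/esym/lebesgue_measure_unique => // _ [[x y] _ <-].
rewrite /nu/= /pushforward.
rewrite (_ : _ @^-1` _ = `](x - a), (y - a)]%classic); last first.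
  by apply/seteqP; split => z /=; rewrite !in_itv/= ltrBlDr lerBrDr.
have := lebesgue_measure_itv `](x - a), (y - a)]%R => /= ->.
have := lebesgue_measure_itv `]x, y]%R => /= ->.
by rewrite !lte_fin ltrD2r -!EFinD opprD addrACA subrr addr0.
Qed.

Definition addt n (x y : n.-tuple RT) : n.-tuple RT :=
  [tuple tnth x i + tnth y i | i < n].

Definition oppt n (x : n.-tuple RT) : n.-tuple RT := [tuple - tnth x i | i < n].

Lemma addtC n (x y : n.-tuple RT) : addt x y = addt y x.
Proof. by apply/eq_from_tnth => i; rewrite !tnth_mktuple addrC. Qed.

Lemma addtK n (x y : n.-tuple RT) : addt (addt x y) (oppt y) = x.
Proof. by apply/eq_from_tnth => i; rewrite !tnth_mktuple addrK. Qed.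

Lemma opptB n (x y : n.-tuple RT) : oppt (addt x (oppt y)) = addt y (oppt x).
Proof. by apply/eq_from_tnth => i; rewrite !tnth_mktuple opprB. Qed.

Lemma addt_cons n (a b : RT) (x y : n.-tuple RT) :
  addt [tuple of a :: x] [tuple of b :: y] = [tuple of (a + b) :: addt x y].
Proof.
apply/eq_from_tnth => i; rewrite tnth_mktuple.
by case: (unliftP ord0 i) => [j ->|->]; rewrite ?tnthS ?tnth_mktuple// !tnth0.
Qed.

Lemma dotp_oppt n (x : n.-tuple RT) : dotp (oppt x) (oppt x) = dotp x x.
Proof. by apply: eq_bigr => i _; rewrite !tnth_mktuple mulrNN. Qed.

Lemma measurable_tuple d (T : measurableType d) n (f : 'I_n -> T -> RT) :
  (forall i, measurable_fun setT (f i)) ->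
  measurable_fun setT (fun x => [tuple f i x | i < n] : n.-tuple RT).
Proof.
move=> mf; apply/measurable_fun_tnthP => i.
rewrite (_ : _ \o _ = f i); first exact: mf.
by apply/funext => x /=; rewrite tnth_mktuple.
Qed.

Lemma measurable_tnth_comp d (T : measurableType d) n i (f : T -> n.-tuple RT) :
  measurable_fun setT f -> measurable_fun setT (fun x => tnth (f x) i).
Proof. by move=> mf; exact: (measurableT_comp (measurable_tnth i)). Qed.

Lemma measurable_addt d (T : measurableType d) n (f g : T -> n.-tuple RT) :
  measurable_fun setT f -> measurable_fun setT g ->
  measurable_fun setT (fun x => addt (f x) (g x)).
Proof.
move=> mf mg; apply: measurable_tuple => i.
by apply: measurable_funD; exact: measurable_tnth_comp.
Qed.

Lemma measurable_oppt d (T : measurableType d) n (f : T -> n.-tuple RT) :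
  measurable_fun setT f -> measurable_fun setT (fun x => oppt (f x)).
Proof.
by move=> mf; apply: measurable_tuple => i; apply: measurable_funN; exact: measurable_tnth_comp.
Qed.

Lemma measurable_preim d d' (S : measurableType d) (T : measurableType d')
  (f : S -> T) (A : set T) : measurable_fun setT f -> measurable A ->
  measurable [set x | A (f x)].
Proof. by move=> mf mA; rewrite -[X in measurable X]setTI; exact: mf. Qed.

(** By slices: the induction hypothesis translates the tail, invariance on the line translates the
    head. *)
Lemma lebesgue_tuple_shift n (v : n.-tuple RT) (A : set (n.-tuple RT)) :
  measurable A -> leb [set x | A (addt x v)] = leb A.
Proof.
elim: n v A => [|n ih] v A mA.
  congr (_ _); apply/seteqP; split => x /=;
    by rewrite (_ : addt x v = x)//; apply/eq_from_tnth => -[].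
case/tupleP: v => a v; rewrite /=.
have mcons (x : RT) : measurable [set t : n.-tuple RT | A [tuple of x :: t]].
  apply: (measurable_preim (f := fun t : n.-tuple RT => [tuple of x :: t])) => //.
  by apply: measurable_cons; [exact: measurable_cst|exact: measurable_id].
pose F (x : RT) := leb [set t : n.-tuple RT | A [tuple of x :: t]].
have mF : measurable_fun setT F.
  have mA' : measurable [set z : RT * n.-tuple RT | A [tuple of z.1 :: z.2]].
    by apply: (measurable_preim (f := fun z : RT * n.-tuple RT => [tuple of z.1 :: z.2])) => //;
      exact: measurable_cons.
  rewrite (_ : F = leb \o xsection [set z : RT * n.-tuple RT | A [tuple of z.1 :: z.2]]).
    exact: measurable_fun_xsection.
  apply/funext => x /=; congr lebesgue_tuple.
  by apply/seteqP; split => t; rewrite /xsection/= inE.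
transitivity (\int[@lebesgue_measure R]_x F (x + a)%R)%E.
  apply: eq_integral => x _.
  rewrite /F -(ih v [set t : n.-tuple RT | A [tuple of (x + a : RT) :: t]])//.
  by congr lebesgue_tuple; apply/seteqP; split => t /=; rewrite addt_cons.
have ms : measurable_fun setT (fun x : RT => x + a : RT).
  by apply: measurable_funD => //; exact: measurable_cst.
have F0 x : (0 <= F x)%E by exact: measure_ge0.
rewrite -[LHS](@ge0_integral_pushforward _ _ RT RT R (fun x : RT => x + a) ms
  (@lebesgue_measure R) setT F)//.
by apply: eq_measure_integral => B mB _; exact: lebesgue_measure_shift.
Qed.

Let integral_section1 n (A B : set (n.-tuple RT)) (Z : set (n.-tuple RT * n.-tuple RT)) c :
  measurable A -> measurable Z ->
  (forall x, A x -> leb (xsection Z x) = c) ->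
  (forall x, ~ A x -> xsection Z x = set0) -> (0 <= c)%E ->
  (\int[leb]_x leb (xsection Z x) = leb A * c)%E.
Proof.
move=> mA mZ Ac A0 c0.
have -> : leb A = (\int[leb]_x (\1_A x)%:E)%E by rewrite integral_indic// setIT.
rewrite -ge0_integralZr//; last first.
- exact/measurable_EFinP.
apply: eq_integral => x _; rewrite indicE.
have [xA|xA] := boolP (x \in A); first by rewrite mul1e Ac//; exact/set_mem.
by rewrite mul0e A0 ?measure0//; apply: contraNnot xA => /mem_set.
Qed.

Let tonelli_sections n (Z : set (n.-tuple RT * n.-tuple RT)) : measurable Z ->
  (\int[leb]_x leb (xsection Z x) = \int[leb]_y leb (ysection Z y))%E.
Proof.
move=> mZ; have := indic_fubini_tonelli (@lebesgue_tuple R n) (@lebesgue_tuple R n) mZ.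
by rewrite indic_fubini_tonelli_FE// indic_fubini_tonelli_GE.
Qed.

(* With [Z = {(x, y) | x in A, L y - x in B}], Tonelli's theorem and the
   translation invariance give [leb A * leb (L^-1 B) = leb (L^-1 A) * leb (- B)];
   here [B] is the unit ball, so [L^-1 B = B = - B]. *)
Lemma lebesgue_tuple_isometry n (L : n.-tuple RT -> n.-tuple RT)
    (A : set (n.-tuple RT)) :
  measurable_fun setT L -> involutive L ->
  (forall x y, L (addt x y) = addt (L x) (L y)) ->
  (forall x, dotp (L x) (L x) = dotp x x) ->
  measurable A -> leb [set x | A (L x)] = leb A.
Proof.
move=> mL LK LD Ldot mA; pose B := @unit_ball R n.
(* Additivity suffices: [w], the image of the origin, satisfies [w + w = w]. *)
have LN x : L (oppt x) = oppt (L x).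
  have L0 : L (oppt x) = addt (L (addt (oppt x) x)) (oppt (L x)) by rewrite LD addtK.
  rewrite L0 (_ : addt (oppt x) x = addt (addt x (oppt x)) (addt x (oppt x))); last first.
    by apply/eq_from_tnth => i; rewrite !tnth_mktuple; ring.
  rewrite LD; set w := L _.
  have : addt w w = w.
    rewrite /w -LD; congr L; apply/eq_from_tnth => i; rewrite !tnth_mktuple; ring.
  move=> ww; rewrite ww; apply/eq_from_tnth => i; rewrite !tnth_mktuple.
  have : tnth (addt w w) i = tnth w i by rewrite ww.
  by rewrite tnth_mktuple; lra.
have mB : measurable B by exact: measurable_unit_ball.
have mLA : measurable [set x | A (L x)] by exact: measurable_preim.
pose Z := [set z : n.-tuple RT * n.-tuple RT | A z.1 /\ B (addt (L z.2) (oppt z.1))].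
(* For each [y], the section of [Z'] is that of [Z] translated by [- L y], in view of the symmetry
   of the ball. *)
pose Z' := [set z : n.-tuple RT * n.-tuple RT | B z.1 /\ A (addt z.1 (L z.2))].
have m1 : measurable_fun setT (fun z : n.-tuple RT * n.-tuple RT => z.1) by exact: measurable_fst.
have m2 : measurable_fun setT (fun z : n.-tuple RT * n.-tuple RT => L z.2).
  exact: measurableT_comp.
have mZ : measurable Z.
  apply: measurableI; first exact: measurable_preim m1 mA.
  by apply: (measurable_preim _ mB); apply: measurable_addt => //; exact: measurable_oppt.
have mZ' : measurable Z'.
  apply: measurableI; first exact: measurable_preim m1 mB.
  by apply: (measurable_preim _ mA); exact: measurable_addt.
have Z1 : (\int[leb]_x leb (xsection Z x) = leb A * leb B)%E.
  apply: integral_section1 => // x Ax.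
    rewrite -(lebesgue_tuple_shift (oppt (L x)) mB); congr lebesgue_tuple.
    apply/seteqP; split => y; rewrite /xsection/= inE/=.
      by move=> [_]; rewrite /B /unit_ball/= -Ldot LD LK LN.
    by move=> h; split=> //; move: h; rewrite /B /unit_ball/= -Ldot LD LN LK.
  by apply/seteqP; split => y //; rewrite /xsection/= inE/= => -[].
have Z1' : (\int[leb]_x leb (xsection Z' x) = leb B * leb [set x | A (L x)])%E.
  apply: integral_section1 => // x Bx.
    rewrite -(lebesgue_tuple_shift (L x) mLA); congr lebesgue_tuple.
    apply/seteqP; split => y; rewrite /xsection/= inE/= LD LK addtC; first by case.
    by [].
  by apply/seteqP; split => y //; rewrite /xsection/= inE/= => -[].
have Z2 y : leb (ysection Z y) = leb (ysection Z' y).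
  rewrite -(lebesgue_tuple_shift (L y)); last exact: measurable_ysection.
  congr lebesgue_tuple; apply/seteqP; split => x; rewrite /ysection/= !inE/=;
    rewrite /Z /Z' /B /unit_ball/= -opptB addtK dotp_oppt.
    by case.
  by case.
have : (leb A * leb B = leb B * leb [set x | A (L x)])%E.
  rewrite -Z1 -Z1' !tonelli_sections//.
  by apply: eq_integral => y _.
have := unit_ball_lty n (R := R); have := unit_ball_gt0 n (R := R); rewrite -/B.
case: (leb B) => // b; rewrite lte_fin => b0 _.
rewrite muleC => /esym /(congr1 (mule (b^-1)%:E)).
by rewrite !muleA -!EFinM mulVf ?gt_eqF// !mul1e.
Qed.

End lebesgue_tuple_invariance.

(** * Isometries of the sphere *)

Section sphere_measure.
Context {R : realType}.
Local Notation RT := (measurableTypeR R).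
Local Notation leb := (@lebesgue_tuple R _).

Lemma measurable_continuous_borel (X : pointedMetricType R) (f : X -> R) :
  continuous f -> measurable_fun setT (f : borel X -> RT).
Proof.
move=> /continuousP cf.
apply: (measurability _ (RGenOpens.measurableE R)) => _ [_ [a [b ->] <-]].
rewrite setTI; apply: sub_sigma_algebra.
by apply: cf; exact: interval_open.
Qed.

Lemma measurable_mdist_borel (X Y : pointedMetricType R) (f : X -> Y) :
  (forall x y, mdist (f x) (f y) = mdist x y) ->
  measurable_fun setT (f : borel X -> borel Y).
Proof.
move=> df; apply: (@measurability _ _ (borel X) (borel Y) setT f open) => //.
move=> _ [U oU <-]; rewrite setTI; apply: sub_sigma_algebra.
have /continuousP : continuous f; last exact.
move=> x; apply/cvg_ballP => e e0; near=> y.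
rewrite ballEmdist/= df.
have : ball x e y by near: y; exact: nbhsx_ballx.
by rewrite ballEmdist.
Unshelve. all: by end_near. Qed.

Lemma sphere_mdistE n (u v : sphere R n) : mdist u v = sphere_dist u v.
Proof. by []. Qed.

(** Involutions cover the antipode and the reflections, and spare a separate inverse. Scalars act on
    the right to match the normalization in [sphere_proj]. *)
Definition linear_isometry n (L : n.-tuple RT -> n.-tuple RT) : Prop :=
  [/\ measurable_fun setT L, involutive L,
      forall x y, L (addt x y) = addt (L x) (L y),
      forall (c : R) x, L [tuple tnth x i * c | i < n] = [tuple tnth (L x) i * c | i < n] &
      forall x y, dotp (L x) (L y) = dotp x y].

Lemma sphere_map_subproof n (L : n.+1.-tuple RT -> n.+1.-tuple RT) (u : sphere R n) :
  linear_isometry L -> dotp (L u) (L u) == 1.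
Proof. by case=> _ _ _ _ ->; rewrite dotp_sphere. Qed.

Definition sphere_map n (L : n.+1.-tuple RT -> n.+1.-tuple RT)
  (iL : linear_isometry L) (u : sphere R n) : sphere R n :=
  @Sphere R n (L u) (sphere_map_subproof u iL).

Lemma sphere_map_dist n (L : n.+1.-tuple RT -> n.+1.-tuple RT)
    (iL : linear_isometry L) (u v : sphere R n) :
  sphere_dist (sphere_map iL u) (sphere_map iL v) = sphere_dist u v.
Proof. by have [_ _ _ _ Ldot] := iL; rewrite /sphere_dist /= Ldot. Qed.

Lemma sphere_mapK n (L : n.+1.-tuple RT -> n.+1.-tuple RT)
    (iL : linear_isometry L) : involutive (sphere_map iL).
Proof. by move=> u; apply/val_inj; have [_ LK _ _ _] := iL; rewrite /= LK. Qed.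

(** [sphere_proj] sends the origin to the pole, which an isometry need not fix; the origin thus has
    to be discarded as a null set. *)
Let null_origin n : leb [set x : n.+1.-tuple RT | dotp x x <= 0] = 0%E.
Proof.
apply/eqP; rewrite eq_le measure_ge0 andbT.
have <- : leb (@cube R n.+1 0) = 0%E.
  by rewrite lebesgue_tuple_cube// mulr0 expr0n.
apply: le_measure; rewrite ?inE; last 2 first.
- exact: measurable_cube.
- move=> x /= x0 i; rewrite normr_le0; apply/eqP; apply: dotp_eq0.
  by apply/eqP; rewrite eq_le x0 dotp_ge0.
apply: (measurable_preim (f := fun x : n.+1.-tuple RT => dotp x x : RT)
  (A := `]-oo, 0]%classic)).
  by apply: measurable_dotp; exact: measurable_id.
exact: measurable_itv.
Qed.

Lemma measurable_sphere_map n (L : n.+1.-tuple RT -> n.+1.-tuple RT)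
    (iL : linear_isometry L) :
  measurable_fun setT (sphere_map iL : borel (sphere R n) -> borel (sphere R n)).
Proof. by apply: measurable_mdist_borel; exact: sphere_map_dist. Qed.

Lemma nvol_sphere_map n (L : n.+1.-tuple RT -> n.+1.-tuple RT)
    (iL : linear_isometry L) (A : set (borel (sphere R n))) :
  measurable A -> nvol R n (sphere_map iL @^-1` A) = nvol R n A.
Proof.
move=> mA; rewrite /nvol; congr (_ * _)%E; have [mL LK LD LZ Ldot] := iL.
set B := unit_ball n.+1.
have mB : measurable B by exact: measurable_unit_ball.
have mP (C : set (borel (sphere R n))) : measurable C ->
    measurable (@sphere_proj R n @^-1` C `&` B).
  move=> mC; apply: measurableI => //.
  by rewrite -[X in measurable X]setTI; exact: measurable_sphere_proj.
have mA' : measurable (sphere_map iL @^-1` A : set (borel (sphere R n))).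
  by rewrite -[X in measurable X]setTI; exact: measurable_sphere_map.
rewrite -(lebesgue_tuple_isometry mL LK LD _ (mP _ mA)); last by move=> x; exact: Ldot.
have LA : measurable [set x | (@sphere_proj R n @^-1` A `&` B) (L x)].
  exact: measurable_preim mL (mP _ mA).
pose O := [set x : n.+1.-tuple RT | dotp x x <= 0].
have mO : measurable O.
  apply: (measurable_preim (f := fun x : n.+1.-tuple RT => dotp x x : RT)
    (A := `]-oo, 0]%classic)).
    by apply: measurable_dotp; exact: measurable_id.
  exact: measurable_itv.
have D0 (C : set (n.+1.-tuple RT)) : measurable C -> leb C = leb (C `\` O).
  move=> mC; apply/eqP; rewrite eq_le; apply/andP; split; last first.
    by apply: le_measure; rewrite ?inE//; exact: measurableD.
  rewrite -[leRHS]adde0 -(null_origin n).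
  apply: (@le_trans _ _ (leb ((C `\` O) `|` O))).
    apply: le_measure; rewrite ?inE//; first by apply: measurableU => //; exact: measurableD.
    by move=> x Cx; have [Ox|Ox] := pselect (O x); [right|left].
  by apply: measureU2 => //; exact: measurableD.
rewrite (D0 _ (mP _ mA')) (D0 _ LA); congr lebesgue_tuple.
(* Off the origin the radial projection commutes with [L], so the two truncated cones correspond
   under [L]. *)
have proj x : ~ O x -> sphere_proj (L x) = sphere_map iL (sphere_proj x).
  move=> /= /negP; rewrite -ltNge => x0.
  apply/val_inj/eq_from_tnth => i.
  rewrite sphere_projE ?Ldot// /sphere_map/=.
  rewrite (_ : sphere_val (sphere_proj x) =
    [tuple tnth x j * (Num.sqrt (dotp x x))^-1 | j < n.+1]).
    by rewrite LZ tnth_mktuple.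
  by apply/eq_from_tnth => j; rewrite sphere_projE// tnth_mktuple.
apply/seteqP; split => x /= [[h1 h2] Ox]; split => //; split.
- by rewrite proj.
- by rewrite /B /unit_ball/= Ldot.
- by rewrite -proj.
- by move: h2; rewrite /B /unit_ball/= Ldot.
Qed.

Lemma Rint_sphere_map n (L : n.+1.-tuple RT -> n.+1.-tuple RT)
    (iL : linear_isometry L) (f : borel (sphere R n) -> R) : bmeas f ->
  \int[nvol R n]_x f (sphere_map iL x) = \int[nvol R n]_x f x.
Proof.
move=> bf; rewrite /Rintegral; congr fine.
have ms := measurable_sphere_map iL.
rewrite -[LHS](@integral_pushforward _ _ _ (borel (sphere R n)) R _ ms (nvol R n)
  setT (EFin \o f))//.
- by apply: eq_measure_integral => A mA _; exact: nvol_sphere_map.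
- by case: bf => mf _; exact/measurable_EFinP.
- exact: (bmeas_integrable (nvol R n) (bmeas_comp ms bf)).
Qed.

Lemma linear_isometry_opp n : linear_isometry (@oppt R n).
Proof.
split.
- by apply: measurable_oppt; exact: measurable_id.
- by move=> x; apply/eq_from_tnth => i; rewrite !tnth_mktuple opprK.
- by move=> x y; apply/eq_from_tnth => i; rewrite !tnth_mktuple opprD.
- by move=> c x; apply/eq_from_tnth => i; rewrite !tnth_mktuple mulNr.
- by move=> x y; apply: eq_bigr => i _; rewrite !tnth_mktuple mulrNN.
Qed.

Definition antipode n : sphere R n -> sphere R n :=
  sphere_map (linear_isometry_opp n.+1).

(** Householder reflection in the hyperplane orthogonal to [w]. *)
Definition reflectt n (w x : n.-tuple RT) : n.-tuple RT :=
  [tuple tnth x i - 2 * dotp x w / dotp w w * tnth w i | i < n].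

Lemma dotp_reflectt n (w x y : n.-tuple RT) :
  dotp (reflectt w x) y = dotp x y - 2 * dotp x w / dotp w w * dotp w y.
Proof.
rewrite /dotp mulr_sumr -sumrB; apply: eq_bigr => i _.
by rewrite tnth_mktuple mulrBl mulrA.
Qed.

Lemma linear_isometry_reflectt n (w : n.-tuple RT) :
  dotp w w != 0 -> linear_isometry (reflectt w).
Proof.
move=> w0; split.
- apply: measurable_tuple => i; apply: measurable_funB; first exact: measurable_tnth.
  apply: measurable_funM; last exact: measurable_cst.
  apply: measurable_funM; last exact: measurable_cst.
  apply: measurable_funM; first exact: measurable_cst.
  by apply: measurable_dotp; [exact: measurable_id|exact: measurable_cst].
- move=> x; apply/eq_from_tnth => i; rewrite tnth_mktuple dotp_reflectt tnth_mktuple.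
  by field.
- move=> x y; apply/eq_from_tnth => i; rewrite !tnth_mktuple.
  have -> : dotp (addt x y) w = dotp x w + dotp y w.
    by rewrite -big_split; apply: eq_bigr => j _; rewrite tnth_mktuple mulrDl.
  by ring.
- move=> c x; apply/eq_from_tnth => i; rewrite !tnth_mktuple.
  have -> : dotp [tuple tnth x i * c | i < n] w = dotp x w * c.
    by rewrite mulr_suml; apply: eq_bigr => j _; rewrite tnth_mktuple mulrAC.
  by ring.
- move=> x y; rewrite dotp_reflectt (dotpC x (reflectt w y)) (dotpC w (reflectt w y)).
  by rewrite !dotp_reflectt (dotpC y x) (dotpC w x); field.
Qed.

(** Reflection in the bisecting hyperplane, with [w = u - v]. As [u] and [v] have the same norm,
    [<w, w> = 2 <u, w>], and [u] goes to [u - w = v]. *)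
Lemma sphere_transitive n (u v : sphere R n) : u != v ->
  exists (L : n.+1.-tuple RT -> n.+1.-tuple RT) (iL : linear_isometry L),
    sphere_map iL u = v.
Proof.
move=> uv; pose w : n.+1.-tuple RT := [tuple tnth u i - tnth v i | i < n.+1].
have dw x : dotp x w = dotp x u - dotp x v.
  by rewrite -sumrB; apply: eq_bigr => i _; rewrite tnth_mktuple mulrBr.
have ww : dotp w w = 2 * dotp u w.
  by rewrite dw !(dotpC w) !dw !dotp_sphere (dotpC v u); ring.
have w0 : dotp w w != 0.
  apply: contra uv => /eqP w0; apply/eqP/val_inj/eq_from_tnth => i.
  apply/eqP; rewrite -subr_eq0; have := dotp_eq0 w0 i; rewrite tnth_mktuple => ->.
  exact: eqxx.
exists (reflectt w), (linear_isometry_reflectt w0).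
apply/val_inj/eq_from_tnth => i; rewrite /= tnth_mktuple -ww divff// mul1r.
by rewrite tnth_mktuple subKr.
Qed.

End sphere_measure.

(** * Full support of the volume of the sphere *)

Section sphere_full_support.
Context {R : realType}.
Local Notation RT := (measurableTypeR R).
Local Notation leb := (@lebesgue_tuple R _).

Lemma open_sphere_ball n (u : sphere R n) (e : R) :
  open [set v | sphere_dist u v < e].
Proof.
rewrite openE => v /= uv; rewrite /interior -nbhs_ballE.
exists (e - sphere_dist u v); first by rewrite /= subr_gt0.
move=> w; rewrite ballEmdist/= sphere_mdistE => vw.
by apply: le_lt_trans (sphere_dist_triangle v u w) _; rewrite addrC -ltrBrDr.
Qed.

(* The cone over a spherical ball contains a cube centred at u / 2. *)
Lemma nvol_ball_gt0 n (u : sphere R n) (e : R) : 0 < e ->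
  (0 < nvol R n [set v | (sphere_dist u v < e)%R])%E.
Proof.
move=> e0; pose e' := Num.min e pi; pose c := cos e'.
have e'0 : 0 < e' by rewrite lt_min e0 pi_gt0.
have e'pi : e' <= pi by rewrite ge_min lexx orbT.
have c1 : c < 1 by rewrite -cos0 ltr_cos// in_itv/= ?lexx ?pi_ge0// (ltW e'0).
have cN1 : -1 <= c by exact: cos_geN1.
(* A point [x] of the cube has [<u, x> >= 1/2 - s] and [|x| <= 1/2 + s]. The cosine of its angle
   with [u] thus exceeds [1 - 8 s = c]. Dividing [s] by [n.+1] makes the coordinate errors add up to
   [s]. *)
pose s := (1 - c) / 8; pose r := s / n.+1%:R.
have s0 : 0 < s by rewrite divr_gt0// subr_gt0.
have r0 : 0 < r by rewrite divr_gt0.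
have nr : \sum_(i < n.+1) r = s.
  by rewrite sumr_const card_ord -mulr_natr divfK.
have rs : r <= s by rewrite ler_pdivrMr// ler_peMr ?(ltW s0)// ler1n.
pose a : n.+1.-tuple RT := [tuple - (tnth u i / 2) | i < n.+1].
pose Q := [set x | cube r (addt x a)].
have mQ : measurable Q.
  apply: (measurable_preim (f := fun x => addt x a) (A := cube r)).
    apply: (measurable_addt (f := id) (g := fun=> a)); first exact: measurable_id.
    exact: measurable_cst.
  exact: measurable_cube.
have Q0 : (0 < leb Q)%E.
  rewrite lebesgue_tuple_shift; last exact: measurable_cube.
  by rewrite lebesgue_tuple_cube ?(ltW r0)// lte_fin exprn_gt0// mulr_gt0.
pose U := [set v : borel (sphere R n) | (sphere_dist u v < e)%R].
have mU : measurable U.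
  by apply: sub_sigma_algebra; exact: open_sphere_ball.
have QU : Q `<=` (@sphere_proj R n @^-1` U `&` unit_ball n.+1).
  move=> x /= Qx; pose h i := tnth x i - tnth u i / 2.
  have hr i : `|h i| <= r by have := Qx i; rewrite !tnth_mktuple.
  have hu : `|\sum_i tnth u i * h i| <= s.
    apply: le_trans (ler_norm_sum _ _ _) _; rewrite -nr; apply: ler_sum => i _.
    by rewrite normrM -[leRHS]mul1r ler_pM// sphere_coord_le1.
  have hh : \sum_i h i ^+ 2 <= s * s.
    rewrite -{1}nr mulr_suml; apply: ler_sum => i _; rewrite -[leLHS]ger0_norm ?sqr_ge0//.
    by rewrite normrX expr2 ler_pM// (le_trans (hr i)).
  have uxE : dotp u x = 2^-1 + \sum_i tnth u i * h i.
    rewrite (_ : 2^-1 = 2^-1 * dotp u u); last by rewrite dotp_sphere mulr1.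
    rewrite mulr_sumr -big_split; apply: eq_bigr => i _ /=.
    by rewrite /h; field.
  have xxE : dotp x x = 4^-1 + \sum_i tnth u i * h i + \sum_i h i ^+ 2.
    rewrite (_ : 4^-1 = 4^-1 * dotp u u); last by rewrite dotp_sphere mulr1.
    rewrite mulr_sumr -!big_split; apply: eq_bigr => i _ /=.
    by rewrite /h; field.
  move: hu; rewrite ler_norml => /andP[hu1 hu2].
  have cs : c = 1 - 8 * s by rewrite /s; field.
  have s4 : s <= 4^-1 by move: cN1; rewrite cs; lra.
  have xx0 : 0 < dotp x x.
    have := dotp_CauchySchwarz u x; rewrite dotp_sphere mul1r; apply: lt_le_trans.
    by rewrite exprn_gt0// uxE; lra.
  have sq : Num.sqrt (dotp x x) <= 2^-1 + s.
    rewrite -[leRHS]ger0_norm; last by lra.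
    by rewrite -sqrtr_sqr ler_wsqrtr// xxE; nra.
  split; last by rewrite /unit_ball/= xxE; nra.
  rewrite /U/=; apply: (@lt_le_trans _ _ e'); last by rewrite ge_min lexx.
  rewrite -ltr_cos ?in_itv/= ?sphere_dist_ge0 ?sphere_dist_lepi ?(ltW e'0)//.
  rewrite cos_sphere_dist -/c.
  rewrite (_ : dotp u _ = dotp u x / Num.sqrt (dotp x x)); last first.
    by rewrite /dotp mulr_suml; apply: eq_bigr => i _; rewrite sphere_projE// mulrA.
  rewrite ltr_pdivlMr ?sqrtr_gt0//.
  have := sqrtr_ge0 (dotp x x); move: (Num.sqrt _) sq => q q1 q0.
  rewrite uxE cs; have [c0|c0] := leP (1 - 8 * s) 0; nra.
have mQU : measurable (@sphere_proj R n @^-1` U `&` unit_ball n.+1).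
  apply: measurableI; last exact: measurable_unit_ball.
  by rewrite -[X in measurable X]setTI; exact: measurable_sphere_proj.
rewrite /nvol mule_gt0//.
  rewrite lte_fin invr_gt0 fine_gt0// unit_ball_lty andbT.
  exact: unit_ball_gt0.
by apply: lt_le_trans Q0 _; apply: le_measure; rewrite ?inE.
Qed.

(** The set where [f] exceeds [c] is open; if nonempty, it contains a ball, of positive volume. *)
Lemma sphere_ae_le n (f : sphere R n -> R) (c : R) : continuous f ->
  {ae nvol R n, forall x, f x <= c} -> forall x, f x <= c.
Proof.
move=> cf [N [mN N0 fN]] x; rewrite leNgt; apply/negP => cx.
have : \forall y \near x, c < f y by exact: cvgr_gt (cf x) _ cx.
move=> /nbhs_ballP[e /= e0 eP].
have := nvol_ball_gt0 x e0; rewrite ltNge => /negP; apply.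
rewrite -N0; apply: le_measure; rewrite ?inE//.
- by apply: sub_sigma_algebra; exact: open_sphere_ball.
- move=> v vx; apply: fN => /=; apply/negP; rewrite -ltNge; apply: eP.
  by rewrite ballEmdist.
Qed.

Lemma sphere_ae_norm_le n (f : sphere R n -> R) (c : R) : continuous f ->
  {ae nvol R n, forall x, `|f x| <= c} -> forall x, `|f x| <= c.
Proof.
move=> cf fc; apply: (sphere_ae_le (f := fun x => `|f x|)) => // x.
by apply: (@continuous_comp _ _ _ f (@Num.norm R R)); [exact: cf|exact: norm_continuous].
Qed.

Lemma sphere_ae_eq n (f g : sphere R n -> R) : continuous f -> continuous g ->
  {ae nvol R n, forall x, f x = g x} -> forall x, f x = g x.
Proof.
move=> cf cg fg x; apply/eqP; rewrite -subr_eq0 -normr_le0.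
apply: (@sphere_ae_norm_le _ (fun x => f x - g x) 0).
  by move=> y; apply: (@continuousB _ _ _ f g); [exact: cf|exact: cg].
by apply: ae_imp fg => y ->; rewrite subrr normr0.
Qed.

End sphere_full_support.

(** * The cMDS kernel of the sphere *)

Lemma continuous_mdist_lip (R : realType) (X : pointedMetricType R) (f : X -> R) (k : R) :
  0 < k -> (forall u v, `|f u - f v| <= k * mdist u v) -> continuous f.
Proof.
move=> k0 fk u; apply/cvgrPdist_lt => e e0; near=> v.
apply: le_lt_trans (fk u v) _; rewrite mulrC -ltr_pdivlMr//.
have : ball u (e / k) v by near: v; apply: nbhsx_ballx; exact: divr_gt0.
by rewrite ballEmdist.
Unshelve. all: by end_near. Qed.

Section sphere_kernels.
Context {R : realType} (n : nat).
Local Notation RT := (measurableTypeR R).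
Local Notation S := (sphere R n).
Local Notation mu := (nvol R n).
Implicit Types u v w : S.

Lemma sphere_dist_lip u v w : `|sphere_dist u w - sphere_dist v w| <= sphere_dist u v.
Proof.
have h1 := sphere_dist_triangle v u w; have h2 := sphere_dist_triangle u v w.
rewrite (sphere_distC v u) in h2.
by rewrite ler_norml; move: h1 h2; lra.
Qed.

Lemma continuous_sphere_dist w : continuous (fun u => sphere_dist u w).
Proof.
by apply: (@continuous_mdist_lip _ _ _ 1) => // u v; rewrite mul1r; exact: sphere_dist_lip.
Qed.

Lemma continuous_dotp w : continuous (fun u : S => dotp u w).
Proof.
rewrite (_ : (fun u => _) = cos \o (fun u => sphere_dist u w)).
  by move=> u; apply: continuous_comp; [exact: continuous_sphere_dist|exact: continuous_cos].
by apply/funext => u /=; rewrite cos_sphere_dist.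
Qed.

Let basis_tuple (i : 'I_n.+1) : n.+1.-tuple R := [tuple (j == i)%:R | j < n.+1].

Let dotp_basis (x : n.+1.-tuple R) i : dotp x (basis_tuple i) = tnth x i.
Proof.
rewrite /dotp (bigD1 i)//= big1 => [|j /negbTE ji]; rewrite tnth_mktuple.
  by rewrite eqxx mulr1 addr0.
by rewrite ji mulr0.
Qed.

Let basis_subproof i : dotp (basis_tuple i) (basis_tuple i) == 1.
Proof. by rewrite dotp_basis tnth_mktuple eqxx. Qed.

Lemma continuous_coord i : continuous (fun u : S => tnth u i).
Proof.
have := @continuous_dotp (@Sphere R n (basis_tuple i) (basis_subproof i)).
rewrite (_ : (fun u => _) = (fun u : S => tnth u i))//.
by apply/funext => u /=; exact: dotp_basis.
Qed.

Lemma measurable_sphere_val :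
  measurable_fun setT (fun u : borel S => sphere_val u : n.+1.-tuple RT).
Proof.
apply/measurable_fun_tnthP => i; apply: measurable_continuous_borel.
exact: continuous_coord.
Qed.

Lemma bmeas_coord i : bmeas (fun u : borel S => tnth u i : R).
Proof.
split; first by apply: measurable_continuous_borel; exact: continuous_coord.
by exists 1 => u; exact: sphere_coord_le1.
Qed.

(** Measurability refers to the product of the two Borel sigma-algebras; it is obtained coordinate
    by coordinate. *)
Lemma bkernel_dotp : bkernel (fun u v : borel S => dotp u v).
Proof.
split; last first.
  by exists 1 => z; have := dotp_sphere_itv (z.1 : S) z.2; rewrite ler_norml.
by apply: measurable_dotp; apply: (measurableT_comp measurable_sphere_val).
Qed.

Lemma bkernel_dotpX m : bkernel (fun u v : borel S => dotp u v ^+ m).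
Proof. exact: bmeasX bkernel_dotp. Qed.

(* Schur: conjugating a positive kernel by [u_i v_i] and summing over [i]
   multiplies it by [dotp u v]. *)
Lemma psd_dotpX m : psd_kernel mu (fun u v : borel S => dotp u v ^+ m).
Proof.
elim: m => [|m ih].
  rewrite (_ : (fun u v => _) = fun _ _ => 1); first exact: psd_cst1.
  by apply/funext => u; apply/funext => v; rewrite expr0.
rewrite (_ : (fun u v => _) = fun u v =>
    \sum_(i < n.+1) tnth u i * tnth v i * dotp u v ^+ m); last first.
  by apply/funext => u; apply/funext => v; rewrite exprS mulr_suml.
apply: psd_sum => i; last first.
  exact: (psd_conj (bmeas_coord i) (bkernel_dotpX m) ih).
by apply: bmeasM (bkernel_dotpX m); exact: bkernel_prod (bmeas_coord i) (bmeas_coord i).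
Qed.

Definition codist u v : R := pi / 2 - sphere_dist u v.

Lemma codistC u v : codist u v = codist v u.
Proof. by rewrite /codist sphere_distC. Qed.

Lemma codist_itv u v : - (pi / 2) <= codist u v <= pi / 2.
Proof. by have := sphere_dist_ge0 u v; have := sphere_dist_lepi u v; rewrite /codist; lra. Qed.

Lemma sin_codist u v : sin (codist u v) = dotp u v.
Proof. by rewrite /codist sinB sin_pihalf cos_pihalf mul1r mul0r subr0 cos_sphere_dist. Qed.

Let Pn m u v : R := (arcsin_poly m).[dotp u v].

Let PnE m u v : Pn m u v = \sum_(k < m) arcsin_coef k * dotp u v ^+ k.*2.+1.
Proof. by rewrite /Pn horner_arcsin_poly. Qed.

Let Pn_le m u v : `|Pn m u v| <= pi / 2.
Proof. by rewrite /Pn -sin_codist; apply: arcsin_poly_le; exact: codist_itv. Qed.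

Let Pn_cvg u v : (fun m => Pn m u v) @ \oo --> codist u v.
Proof.
rewrite (_ : (fun m => _) = fun m => (arcsin_poly m).[sin (codist u v)]).
  by apply: arcsin_poly_cvg; exact: codist_itv.
by apply/funext => m; rewrite sin_codist.
Qed.

Let bPn m : bkernel (Pn m : borel S -> borel S -> R).
Proof.
rewrite (_ : Pn m = fun u v => \sum_(k < m) arcsin_coef k * dotp u v ^+ k.*2.+1).
  by apply: bmeas_sum => k; apply: bmeasZ; exact: bkernel_dotpX.
by apply/funext => u; apply/funext => v; rewrite PnE.
Qed.

(** Joint measurability is inherited from the polynomials in [dotp] that converge to [codist]. *)
Lemma bkernel_codist : bkernel (codist : borel S -> borel S -> R).
Proof.
apply: (@bmeas_cvg _ (borel S * borel S)%type R (fun m z => Pn m z.1 z.2)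
  (fun z => codist z.1 z.2) (pi / 2)).
- by move=> m; case: (bPn m).
- by move=> m z; exact: Pn_le.
- by move=> z; exact: Pn_cvg.
Qed.

Lemma psd_codist : psd_kernel mu (codist : borel S -> borel S -> R).
Proof.
apply: (@psd_cvg _ (borel S) R mu Pn codist (pi / 2) bPn Pn_le Pn_cvg) => m.
rewrite (_ : Pn m = fun u v => \sum_(k < m) arcsin_coef k * dotp u v ^+ k.*2.+1).
  apply: psd_sum => k; first by apply: bmeasZ; exact: bkernel_dotpX.
  by apply: psdZ; [exact: arcsin_coef_ge0|exact: bkernel_dotpX|exact: psd_dotpX].
by apply/funext => u; apply/funext => v; rewrite PnE.
Qed.

Lemma bkernel_codist2 : bkernel (fun u v : borel S => codist u v ^+ 2).
Proof. exact: bmeasX bkernel_codist. Qed.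

(** Squaring the arcsin polynomials keeps the coefficients nonnegative, so the square is again a
    limit of positive combinations of powers of [dotp]. *)
Lemma psd_codist2 : psd_kernel mu (fun u v : borel S => codist u v ^+ 2).
Proof.
apply: (@psd_cvg _ (borel S) R mu (fun m u v => Pn m u v ^+ 2)
  (fun u v => codist u v ^+ 2) ((pi / 2) ^+ 2)).
- by move=> m; apply: bmeasX; exact: bPn.
- by move=> m u v; rewrite normrX lerXn2r ?nnegrE ?divr_ge0 ?pi_ge0.
- by move=> u v; rewrite expr2; under eq_fun do rewrite expr2; apply: cvgM.
move=> m; rewrite (_ : (fun u v => _) = fun u v => \sum_(k < m) \sum_(l < m)
    (arcsin_coef k * arcsin_coef l) * dotp u v ^+ (k.*2.+1 + l.*2.+1)); last first.
  apply/funext => u; apply/funext => v; rewrite PnE expr2 mulr_suml.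
  by apply: eq_bigr => k _; rewrite mulr_sumr; apply: eq_bigr => l _; rewrite exprD; ring.
have bkl (k l : 'I_m) : bkernel (fun u v : borel S =>
    (arcsin_coef k * arcsin_coef l) * dotp u v ^+ (k.*2.+1 + l.*2.+1)).
  by apply: bmeasZ; exact: bkernel_dotpX.
apply: psd_sum => k; first by apply: bmeas_sum => l; exact: bkl.
apply: psd_sum => l; first exact: bkl.
apply: psdZ; [|exact: bkernel_dotpX|exact: psd_dotpX].
by rewrite mulr_ge0 ?arcsin_coef_ge0.
Qed.

Lemma dotp_antipode u v : dotp (antipode u) v = - dotp u v.
Proof. by rewrite /dotp -sumrN; apply: eq_bigr => i _; rewrite tnth_mktuple mulNr. Qed.

Lemma antipodeK : involutive (@antipode R n). Proof. exact: sphere_mapK. Qed.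

Lemma codist_antipodel u v : codist (antipode u) v = - codist u v.
Proof.
by rewrite /codist /sphere_dist dotp_antipode acosN ?dotp_sphere_itv//; field.
Qed.

Lemma codist_antipoder u v : codist u (antipode v) = - codist u v.
Proof. by rewrite codistC codist_antipodel codistC. Qed.

Lemma measurable_antipode :
  measurable_fun setT (@antipode R n : borel S -> borel S).
Proof. exact: measurable_sphere_map. Qed.

Lemma Rint_antipode (f : borel S -> R) : bmeas f ->
  \int[mu]_x f (antipode x) = \int[mu]_x f x.
Proof. exact: Rint_sphere_map. Qed.

Lemma bmeas_mdist2 u : bmeas (fun v : borel S => mdist u v ^+ 2).
Proof.
rewrite (_ : (fun v => _) = fun v => (pi / 2 - codist u v) ^+ 2).
  apply: bmeasX; apply: bmeasB; first exact: bmeas_cst.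
  exact: bkernel_l bkernel_codist.
by apply/funext => v; rewrite /codist subKr.
Qed.

Lemma Rint_mdist2 u v : \int[mu]_x (mdist u x ^+ 2) = \int[mu]_x (mdist v x ^+ 2).
Proof.
have [->//|uv] := eqVneq u v.
have [L [iL Luv]] := sphere_transitive uv.
rewrite -(Rint_sphere_map iL (bmeas_mdist2 v)); apply: eq_Rintegral => x _.
by rewrite -Luv !sphere_mdistE sphere_map_dist.
Qed.

Let c := \int[mu]_x (mdist (point : S) x ^+ 2).

Lemma cmds_kernel_sphereE u v : cmds_kernel mu u v = - 2^-1 * (mdist u v ^+ 2 - c).
Proof.
rewrite /cmds_kernel (Rint_mdist2 u point) -/c.
have -> : \int[mu]_u (mdist u v ^+ 2) = c.
  rewrite /c (Rint_mdist2 point v); apply: eq_Rintegral => x _.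
  by rewrite !sphere_mdistE sphere_distC.
have -> : \int[mu]_u \int[mu]_v (mdist u v ^+ 2) = c.
  rewrite -[RHS](Rint_cst mu); apply: eq_Rintegral => x _; exact: Rint_mdist2.
by rewrite addrNK.
Qed.

Lemma cmds_kernel_codist u v : cmds_kernel mu u v =
  pi / 2 * codist u v - 2^-1 * codist u v ^+ 2 + (c / 2 - pi ^+ 2 / 8).
Proof. by rewrite cmds_kernel_sphereE sphere_mdistE /codist; field. Qed.

End sphere_kernels.

(** * Eigenfunctions of the cMDS operator *)

Section sphere_eigenfunctions.
Context {R : realType} (n : nat).
Local Notation S := (sphere R n).
Local Notation mu := (nvol R n).
Local Notation K := (cmds_kernel mu : borel S -> borel S -> R).
Local Notation A := (codist : borel S -> borel S -> R).
Implicit Types (u v w : S) (f : borel S -> R).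

Definition half_pi_codist u v : R := pi / 2 * codist u v.
Local Notation P := (half_pi_codist : borel S -> borel S -> R).

Let A2 := (fun u v => codist u v ^+ 2) : borel S -> borel S -> R.

Lemma bkernel_half_pi_codist : bkernel P.
Proof. exact: (bmeasZ (pi / 2) (@bkernel_codist R n)). Qed.

Lemma half_pi_codistC u v : P u v = P v u.
Proof. by rewrite /half_pi_codist codistC. Qed.

Lemma psd_half_pi_codist : psd_kernel mu P.
Proof.
by apply: psdZ; [rewrite divr_ge0 ?pi_ge0|exact: bkernel_codist|exact: psd_codist].
Qed.

Let kappa : R := (\int[mu]_x (mdist (point : S) x ^+ 2)) / 2 - pi ^+ 2 / 8.

Let bK : bkernel K.
Proof.
have -> : K = fun u v => P u v - 2^-1 * A2 u v + kappa.
  by apply/funext => u; apply/funext => v; rewrite cmds_kernel_codist.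
apply: bmeasD; last exact: bmeas_cst.
by apply: bmeasB; [exact: bkernel_half_pi_codist|apply: bmeasZ; exact: bkernel_codist2].
Qed.

Let bPu u : bmeas (P u). Proof. exact: (@bkernel_l _ (borel S) R P u bkernel_half_pi_codist). Qed.

Let bA2u u : bmeas (A2 u).
Proof. exact: (@bkernel_l _ (borel S) R A2 u (@bkernel_codist2 R n)). Qed.

Let bKu u : bmeas (K u). Proof. exact: (@bkernel_l _ (borel S) R K u bK). Qed.

Let sK u v : K u v = K v u.
Proof. by rewrite !cmds_kernel_codist codistC. Qed.

Let kopK f u : bmeas f ->
  cmds_op mu f u = kop mu P f u - 2^-1 * kop mu A2 f u + kappa * \int[mu]_x f x.
Proof.
move=> bf; rewrite /cmds_op /kop -!RintZl//; last first.
  exact: (bmeasM (bA2u _) bf).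
have bPf : bmeas (fun v : borel S => P u v * f v).
  exact: (bmeasM (bPu _) bf).
have bAf : bmeas (fun v : borel S => 2^-1 * (A2 u v * f v)).
  exact: (bmeasZ _ (bmeasM (bA2u _) bf)).
rewrite -RintB// -RintD//; [|exact: bmeasB|exact: bmeasZ].
by apply: eq_Rintegral => v _; rewrite cmds_kernel_codist /half_pi_codist /A2 -/kappa; ring.
Qed.

Let Rint_odd f : bmeas f -> (forall u, f (antipode u) = - f u) -> \int[mu]_x f x = 0.
Proof.
move=> bf of_; have := Rint_antipode bf.
have -> : \int[mu]_x f (antipode x) = - \int[mu]_x f x.
  by rewrite -RintN//; apply: eq_Rintegral => x _; exact: of_.
by move/eqP; rewrite eqNr => /eqP.
Qed.

(** The kernel [A2] and the constant are even in the integrated variable, so they integrate an odd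
    [f] to zero. *)
Let kopK_odd f u : bmeas f -> (forall u, f (antipode u) = - f u) ->
  cmds_op mu f u = kop mu P f u.
Proof.
move=> bf of_; rewrite kopK// (Rint_odd bf of_).
have -> : kop mu A2 f u = 0; last by ring.
apply: Rint_odd; first exact: (bmeasM (bA2u _) bf).
by move=> v; rewrite /A2 codist_antipoder of_; ring.
Qed.

(** The kernel [P] is odd in its first variable, hence so is [f], which is [l^-1] times its
    image. *)
Lemma cmds_op_half_pi_codist (l : R) f : 0 < l -> bmeas f ->
  (forall u, kop mu P f u = l * f u) -> forall u, cmds_op mu f u = l * f u.
Proof.
move=> l0 bf Pf u; rewrite kopK_odd// => v.
apply: (mulfI (lt0r_neq0 l0)); rewrite mulrN -!Pf -RintN; last first.
  exact: (bmeasM (bPu _) bf).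
by apply: eq_Rintegral => x _; rewrite /half_pi_codist codist_antipodel; ring.
Qed.

Let K1 u : \int[mu]_v K u v = 0.
Proof.
rewrite /cmds_kernel; set a := \int[mu]_v (mdist u v ^+ 2).
set b := \int[mu]_u \int[mu]_v (mdist u v ^+ 2).
have ab : b = a.
  rewrite -[RHS](Rint_cst mu); apply: eq_Rintegral => x _; exact: Rint_mdist2.
have E v : \int[mu]_u (mdist u v ^+ 2) = a.
  rewrite /a (Rint_mdist2 u v); apply: eq_Rintegral => x _.
  by rewrite !sphere_mdistE sphere_distC.
under eq_Rintegral do rewrite E ab.
rewrite RintZl; last by do 3 (apply: bmeasD; last exact: bmeas_cst); exact: bmeas_mdist2.
under eq_Rintegral do rewrite addrNK.
rewrite RintB; [|exact: bmeas_mdist2|exact: bmeas_cst].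
by rewrite Rint_cst -/a ?ab subrr mulr0.
Qed.

(* The even part [g] of an eigenfunction has mean zero and is annihilated by the
   odd kernel [codist], so that [l g = - 1/2 codist^2 g], which forces [g = 0]
   since [codist^2] is positive semidefinite. *)
Lemma half_pi_codist_cmds_op (l : R) f : 0 < l -> bmeas f ->
  (forall u, cmds_op mu f u = l * f u) -> forall u, kop mu P f u = l * f u.
Proof.
move=> l0 bf Kf.
have bf' : bmeas (fun u : borel S => f (antipode u)).
  exact: (bmeas_comp (@measurable_antipode R n) bf).
pose g : borel S -> R := fun u => f u + f (antipode u).
have bg : bmeas g by exact: bmeasD.
have ge u : g (antipode u) = g u by rewrite /g antipodeK addrC.
have Kg u : cmds_op mu g u = l * g u.
  rewrite -[LHS]/(kop mu K g u) kopD// mulrDr -!Kf; congr (_ + _).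
  rewrite /kop -[LHS]Rint_antipode; last exact: (bmeasM (bKu _) bf').
  apply: eq_Rintegral => v _; rewrite antipodeK; congr (_ * _).
  by rewrite !cmds_kernel_codist codist_antipodel codist_antipoder.
(* Pair [g] with 1: [K] is symmetric and annihilates constants. *)
have g0 : \int[mu]_x g x = 0.
  apply: (mulfI (lt0r_neq0 l0)); rewrite mulr0 -RintZl//.
  have : iprod mu (kop mu K g) (fun=> 1) = iprod mu g (kop mu K (fun=> 1)).
    by apply: kop_sym => //; exact: bmeas_cst.
  have -> : kop mu K (fun=> 1) = fun=> 0.
    apply/funext => u; rewrite -[RHS](K1 u); apply: eq_Rintegral => v _.
    by rewrite mulr1.
  rewrite /iprod; under [in RHS]eq_Rintegral do rewrite mulr0.
  rewrite Rint_cst => <-; apply: eq_Rintegral => x _.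
  by rewrite mulr1 -Kg.
have Pg u : kop mu P g u = 0.
  apply: Rint_odd; first exact: (bmeasM (bPu _) bg).
  by move=> v; rewrite /half_pi_codist codist_antipoder ge; ring.
have A2g u : kop mu A2 g u = - 2 * l * g u.
  by have := Kg u; rewrite kopK// Pg g0 => e; rewrite -mulrA -e; field.
have Ng : iprod mu g g = 0.
  apply/eqP; rewrite eq_le ip_ge0 andbT.
  have := psd_ip_ge0 (@psd_codist2 R n) bg.
  rewrite (_ : kop mu _ g = fun u => - 2 * l * g u); last exact/funext.
  by rewrite ipZl// !mulNr oppr_ge0 pmulr_rle0// mulr_gt0.
(* Zero norm gives [g = 0] only almost everywhere. But [kop mu A2 g] then vanishes at every point,
   and it is a nonzero multiple of [g]. *)
have og u : f (antipode u) = - f u.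
  have : kop mu A2 g u = 0.
    rewrite -[LHS]/(iprod mu (A2 u) g) ipC.
    exact: (ip_eq0 bg (bA2u u) Ng).
  rewrite A2g /g => /eqP; rewrite mulf_eq0 mulf_eq0 oppr_eq0 pnatr_eq0/= gt_eqF//=.
  by rewrite addrC addr_eq0 => /eqP.
by move=> u; rewrite -kopK_odd.
Qed.

(** A difference of squared distances factors, and the sum of the two distances is at most [2 pi];
    the factor one half of the kernel leaves [pi]. *)
Lemma cmds_kernel_lip u v w : `|K u w - K v w| <= pi * sphere_dist u v.
Proof.
rewrite !cmds_kernel_sphereE -mulrBr opprB addrA subrK !sphere_mdistE.
rewrite subr_sqr !normrM normrN.
have h := sphere_dist_lip u v w.
have s : `|sphere_dist u w + sphere_dist v w| <= 2 * pi.
  rewrite ger0_norm ?addr_ge0 ?sphere_dist_ge0//.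
  by have := sphere_dist_lepi u w; have := sphere_dist_lepi v w; lra.
rewrite (ger0_norm (_ : 0 <= 2^-1))//.
have -> : pi * sphere_dist u v = 2^-1 * (sphere_dist u v * (2 * pi)) by field.
by rewrite ler_wpM2l// ler_pM.
Qed.

Lemma continuous_cmds_op f : bmeas f -> continuous (cmds_op mu f : S -> R).
Proof.
move=> bf; case: (bf) => _ [C fC].
have C0 : 0 <= C by exact: le_trans (fC point).
apply: (@continuous_mdist_lip _ _ _ (pi * (C + 1))) => [|u v].
  by rewrite mulr_gt0 ?pi_gt0// ltr_wpDl.
have bKf u' : bmeas (fun x : borel S => K u' x * f x) by exact: (bmeasM (bKu _) bf).
rewrite /cmds_op -RintB//; apply: norm_Rint_le; first exact: bmeasB.
move=> x; rewrite -mulrBl normrM.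
have -> : pi * (C + 1) * mdist u v = (pi * sphere_dist u v) * (C + 1).
  by rewrite sphere_mdistE; ring.
apply: ler_pM => //; first exact: cmds_kernel_lip.
by apply: le_trans (fC x) _; rewrite lerDl.
Qed.

(** The eigenfunction is integrable because [|y| <= 1 + y^2], so its image under the bounded kernel
    is bounded. Dividing by [l] bounds [f] almost everywhere, and continuity extends the bound to
    all points. *)
Lemma cmds_eigenfunction_bmeas (l : R) (f : S -> R) : 0 < l -> continuous f ->
  cmds_eigenfunction mu l f -> bmeas (f : borel S -> R).
Proof.
move=> l0 cf [f2 _ Kf].
have mf : measurable_fun setT (f : borel S -> R) by exact: measurable_continuous_borel.
split => //.
have if1 : mu.-integrable setT (EFin \o (f : borel S -> R)).
  have i2 := Lfun2_integrable_sqr f2.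
  have i1 := bmeas_integrable mu (bmeas_cst _ (1 : R)).
  apply: (le_integrable measurableT _ _ (integrableD measurableT i1 i2)).
    exact/measurable_EFinP.
  move=> x _ /=; rewrite lee_fin [leRHS]ger0_norm ?addr_ge0 ?sqr_ge0//.
  rewrite -[f x ^+ 2](real_normK (num_real _)).
  have := normr_ge0 (f x); move: `|f x| => y y0; nra.
have [_ [C KC]] := bK.
have C0 : 0 <= C by exact: le_trans (KC (point, point)).
pose D := C * \int[mu]_x `|f x|.
have KD x : `|cmds_op mu f x| <= D.
  have iKf : mu.-integrable setT (EFin \o (fun y => K x y * f y)).
    apply: (le_integrable measurableT _ _ (integrableZl measurableT C if1)).
      apply/measurable_EFinP; apply: measurable_funM => //.
      by case: (bKu x).
    move=> y _ /=; rewrite lee_fin (normrM (K x y)) (normrM C) ler_wpM2r//.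
    by rewrite (ger0_norm C0); exact: (KC (x, y)).
  apply: le_trans (le_normr_Rintegral measurableT iKf) _.
  rewrite /D -RintegralZl//; last exact: integrable_norm if1.
  apply: le_Rintegral => //.
  - exact: integrable_norm iKf.
  - exact: (integrableZl measurableT C (integrable_norm if1)).
  - by move=> y _; rewrite (normrM (K x y)) ler_wpM2r//; exact: (KC (x, y)).
exists (D / l); apply: sphere_ae_norm_le => //.
apply: ae_imp Kf => x Kfx; rewrite ler_pdivlMr// -(gtr0_norm l0) -normrM mulrC -Kfx.
exact: KD.
Qed.

End sphere_eigenfunctions.

(** * The embedding of the sphere *)

Section sphere_embedding.
Context {R : realType} (n : nat).
Local Notation S := (sphere R n).
Local Notation mu := (nvol R n).
Local Notation P := (@half_pi_codist R n : borel S -> borel S -> R).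
Variables (lambda : nat -> R) (phi : nat -> S -> R).
Hypothesis spectrum : cmds_spectrum mu lambda phi.

(** The scaling by [sqrt lambda] makes the squared norm of [e i] its eigenvalue, as deflation
    requires, and makes [e i] vanish at the padding indices, where [phi i] is arbitrary. *)
Let e i : borel S -> R := fun u => cmds_embedding lambda phi u i.

Let lambda_ge0 i : 0 <= lambda i. Proof. exact: cmds_ge0 spectrum i. Qed.

Let e0 i : lambda i = 0 -> forall u, e i u = 0.
Proof. by move=> l0 u; rewrite /e /cmds_embedding l0 sqrtr0 mul0r. Qed.

Let bphi i : 0 < lambda i -> bmeas (phi i : borel S -> R).
Proof.
move=> l0; apply: (cmds_eigenfunction_bmeas l0).
  exact: cmds_continuous spectrum i l0.
exact: cmds_eigen spectrum i l0.
Qed.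

Let phi_eigen i : 0 < lambda i -> forall u, cmds_op mu (phi i) u = lambda i * phi i u.
Proof.
move=> l0; apply: sphere_ae_eq.
- exact: continuous_cmds_op (bphi l0).
- move=> u; apply: (@continuousM _ _ (cst (lambda i)) (phi i)); first exact: cst_continuous.
  exact: cmds_continuous spectrum i l0 u.
- by case: (cmds_eigen spectrum l0).
Qed.

Let lambda_case i : lambda i = 0 \/ 0 < lambda i.
Proof.
have := lambda_ge0 i; rewrite le_eqVlt => /predU1P[<-|]; first by left.
by right.
Qed.

Let be i : bmeas (e i).
Proof.
case: (lambda_case i) => [l0|l0].
  by rewrite (_ : e i = fun=> 0); [exact: bmeas_cst|apply/funext => u; exact: e0].
exact: (bmeasZ _ (bphi l0)).
Qed.

Let ce i : continuous (e i : S -> R).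
Proof.
case: (lambda_case i) => [l0|l0].
  by rewrite (_ : e i = fun=> 0); [exact: cst_continuous|apply/funext => u; exact: e0].
move=> u; apply: (@continuousM _ _ (cst (Num.sqrt (lambda i))) (phi i)).
  exact: cst_continuous.
exact: cmds_continuous spectrum i l0 u.
Qed.

Let Pe i u : kop mu P (e i) u = lambda i * e i u.
Proof.
case: (lambda_case i) => [l0|l0].
  rewrite l0 mul0r (_ : e i = fun=> 0); last by apply/funext => x; exact: e0.
  by rewrite /kop; under eq_Rintegral do rewrite mulr0; rewrite Rint_cst.
rewrite [LHS](kopZ mu (Num.sqrt (lambda i)) u (@bkernel_half_pi_codist R n) (bphi l0)).
rewrite (half_pi_codist_cmds_op l0 (bphi l0) (phi_eigen l0)).
by rewrite /e /cmds_embedding mulrCA.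
Qed.

Let ee i j : iprod mu (e i) (e j) = lambda i * (i == j)%:R.
Proof.
case: (lambda_case i) => [l0|li0].
  rewrite l0 mul0r /iprod -[RHS](Rint_cst mu); apply: eq_Rintegral => x _.
  by rewrite e0// mul0r.
case: (lambda_case j) => [l0|lj0].
  rewrite /iprod (_ : (i == j) = false) ?mulr0; last first.
    by apply/eqP => ij; move: li0; rewrite ij l0 ltxx.
  rewrite -[RHS](Rint_cst mu); apply: eq_Rintegral => x _.
  by rewrite (e0 l0) mulr0.
rewrite [LHS](ipZl mu (Num.sqrt (lambda i)) (bphi li0) (be j)).
rewrite (ipZr mu (Num.sqrt (lambda j)) (bphi lj0) (bphi li0)).
rewrite [X in _ * (_ * X)](cmds_orthonormal spectrum li0 lj0) mulrA.
have [<-|] := eqVneq i j; last by rewrite !mulr0.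
by rewrite -expr2 sqr_sqrtr.
Qed.

(** Such an [f] is also an eigenfunction of the cMDS operator, hence a finite combination of the
    [phi i] with eigenvalue [r]. Being orthogonal to them, it is orthogonal to itself. *)
Let complete r (f : borel S -> R) : 0 < r -> bmeas f ->
  (forall u, kop mu P f u = r * f u) ->
  (forall i, iprod mu f (e i) = 0) -> iprod mu f f = 0.
Proof.
move=> r0 bf Pf fe; have [//|ff0] := eqVneq (iprod mu f f) 0.
have ef : cmds_eigenfunction mu r f.
  split.
  - case: (bf) => mf [C fC]; rewrite inE; apply/andP; split; rewrite inE//=.
    rewrite /finite_norm unlock /Lnorm poweR_lty//.
    have := bmeas_integrable mu (bmeasX 2 bf) => /integrableP[_].
    congr (_ < _)%E; apply: eq_integral => x _ /=.
    by rewrite normrX powR_mulrn.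
  - move=> f0; move: ff0; rewrite /iprod -(Rint_cst mu 0) => /eqP; apply.
    apply: eq_Rint_ae; [exact: bmeasM|exact: bmeas_cst|].
    by apply: ae_imp f0 => x ->; rewrite mulr0.
  - by apply: aeW => u; exact: cmds_op_half_pi_codist.
have [N [c fN]] := cmds_complete spectrum r0 ef.
(* The indicator factor replaces the condition of the sum: [phi i] may fail to be measurable when
   [lambda i = 0]. *)
have bs (i : 'I_N) : bmeas (fun x : borel S => (lambda i == r)%:R * (c i * phi i x)).
  case: eqP => [li|_].
    by apply/bmeasZ/bmeasZ/bphi; rewrite li.
  rewrite (_ : (fun x => _) = fun=> 0); first exact: bmeas_cst.
  by apply/funext => x; rewrite mul0r.
pose g (x : borel S) := \sum_(i < N) (lambda i == r)%:R * (c i * phi i x).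
have bg : bmeas g by exact: bmeas_sum.
have fg : {ae mu, forall x, f x = g x}.
  apply: ae_imp fN => x ->; rewrite /g big_mkcond; apply: eq_bigr => i _.
  by case: ifP; rewrite ?mul1r ?mul0r.
have -> : iprod mu f f = iprod mu f g.
  apply: eq_Rint_ae; [exact: bmeasM|exact: bmeasM|].
  by apply: ae_imp fg => x {1}->; rewrite mulrC.
rewrite /iprod.
have E x : f x * g x = \sum_(i < N) f x * ((lambda i == r)%:R * (c i * phi i x)).
  by rewrite mulr_sumr.
under eq_Rintegral do rewrite E.
rewrite Rint_sum; last by move=> i; exact: bmeasM.
rewrite big1// => i _; case: eqP => [li|_]; last first.
  by under eq_Rintegral do rewrite mul0r mulr0; rewrite Rint_cst.
have li0 : 0 < lambda i by rewrite li.
have : iprod mu f (e i) = Num.sqrt (lambda i) * iprod mu f (phi i).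
  exact: (ipZr mu _ (bphi li0) bf).
rewrite fe => /esym/eqP; rewrite mulf_eq0 gt_eqF ?sqrtr_gt0//= => /eqP fphi.
transitivity (c i * iprod mu f (phi i)); last by rewrite fphi mulr0.
rewrite -(ipZr mu _ (bphi li0) bf); apply: eq_Rintegral => x _.
by rewrite mul1r.
Qed.

Let continuous_mercer_sum m u : continuous (mercer_sum e m u : S -> R).
Proof.
elim: m => [|m ih].
  rewrite (_ : mercer_sum e 0 u = fun=> 0); first exact: cst_continuous.
  by apply/funext => x; rewrite /mercer_sum big_nil.
rewrite (_ : mercer_sum e m.+1 u = mercer_sum e m u + cst (e m u) * e m).
  move=> x; apply: continuousD; first exact: ih.
  by apply: continuousM; [exact: cst_continuous|exact: ce].
by apply/funext => x; rewrite /mercer_sum big_nat_recr.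
Qed.

(** A partial sum that is uniformly close to the limit is almost everywhere close to [P u]. Both
    being continuous, they are close everywhere, so the limit agrees with [P u] at each point. *)
Let mercer_eq u v : mercer_lim e u v = P u v.
Proof.
have bP := @bkernel_half_pi_codist R n.
have sP := @half_pi_codistC R n.
have pP := @psd_half_pi_codist R n.
apply/esym/eqP; rewrite -subr_eq0 -normr_le0; apply/ler_addgt0Pl => eps eps0.
rewrite addr0; have eps2 : 0 < eps / 2 by rewrite divr_gt0.
have [m hm] := mercer_tail bP sP pP be Pe ee e0 u eps2.
have ae_eq := mercer_ae bP sP pP be Pe ee e0 complete u.
have bsum : bmeas (mercer_sum e m u : borel S -> R).
  by apply: bmeas_sum => i; exact: bmeasZ.
have Pm v' : `|P u v' - mercer_sum e m u v'| <= eps / 2.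
  move: v'; apply: sphere_ae_norm_le.
    move=> v'; apply: (@continuousB _ _ _ (P u) (mercer_sum e m u)).
      apply: (@continuousM _ _ (cst (pi / 2)) (codist u)); first exact: cst_continuous.
      apply: (@continuousB _ _ _ (cst (pi / 2)) (sphere_dist u)); first exact: cst_continuous.
      rewrite (_ : sphere_dist u = fun x => sphere_dist x u).
        exact: continuous_sphere_dist.
      by apply/funext => x; exact: sphere_distC.
    exact: continuous_mercer_sum.
  apply: ae_imp ae_eq => x ->.
  exact: hm.
rewrite -(subrKA (mercer_sum e m u v)).
apply: le_trans (ler_normD _ _) _; rewrite [leRHS]splitr; apply: lerD; first exact: Pm.
by rewrite distrC; exact: hm.
Qed.

Lemma cmds_embedding_cvg u v :
  (fun m => \sum_(0 <= i < m) (cmds_embedding lambda phi u i - cmds_embedding lambda phi v i) ^+ 2)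
    @ \oo --> pi * sphere_dist u v.
Proof.
have c x y : (fun m => mercer_sum e m x y) @ \oo --> P x y.
  rewrite -mercer_eq; apply: mercer_cvg.
  - exact: bkernel_half_pi_codist.
  - exact: half_pi_codistC.
  - exact: psd_half_pi_codist.
  - exact: be.
  - exact: Pe.
  - exact: ee.
  - exact: e0.
(* [P u u] and [P v v] are [pi^2 / 4], while [P u v] is [pi^2 / 4 - (pi / 2) d(u, v)]. *)
have -> : pi * sphere_dist u v = P u u - 2 * P u v + P v v.
  by rewrite /half_pi_codist /codist !sphere_distxx; field.
rewrite (_ : (fun m => _) = fun m =>
  mercer_sum e m u u - 2 * mercer_sum e m u v + mercer_sum e m v v).
  by apply: cvgD => //; apply: cvgB => //; exact: cvgMl_tmp.
apply/funext => m; rewrite /mercer_sum mulr_sumr -sumrB -big_split.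
by apply: eq_bigr => i _ /=; rewrite /e; ring.
Qed.

(** Bessel's inequality bounds the partial sums by [P u u], so that the embedding takes values in
    [l^2]. *)
Lemma cmds_embedding_sqr_cvg u :
  cvgn (fun m => \sum_(0 <= i < m) cmds_embedding lambda phi u i ^+ 2).
Proof.
apply: nondecreasing_is_cvgn.
  by apply: nondecreasing_series => i _ _; exact: sqr_ge0.
exists (P u u) => _ [m _ <-].
have := @mercer_bessel _ _ _ _ _ _ _ (@bkernel_half_pi_codist R n) (@half_pi_codistC R n)
  (@psd_half_pi_codist R n) be Pe ee e0 m u.
by apply: le_trans; apply: ler_sum => i _; rewrite expr2.
Qed.

End sphere_embedding.

(** * The norm of [l^2] as an L^2 norm for the counting measure *)

Section l2_norm.
Context {R : realType}.
Implicit Types (a : nat -> R) (l : R).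

Lemma Lnorm2_counting a l :
  (fun m => \sum_(0 <= i < m) a i ^+ 2) @ \oo --> l ->
  ('N[@counting _ R]_2%:E [EFin \o a] = (Num.sqrt l)%:E)%E.
Proof.
move=> al; have l0 : 0 <= l.
  rewrite -(cvg_lim _ al)//; apply: limr_ge; first exact: cvgP al.
  by apply: nearW => m; apply: sumr_ge0 => i _; exact: sqr_ge0.
rewrite Lnorm_counting// (_ : (\sum_(k <oo) _)%E = l%:E) ?poweR_EFin ?powR12_sqrt//.
apply/cvg_lim => //.
rewrite (_ : (fun m => _) = EFin \o (fun m => \sum_(0 <= i < m) a i ^+ 2)).
  by apply: cvg_EFin => //; exact: nearW.
apply/funext => m /=; rewrite -sumEFin; apply: eq_bigr => i _.
by rewrite /= powR_mulrn// real_normK ?num_real.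
Qed.

End l2_norm.

(** [sphere R d.-1] is the unit sphere of [R^d]. The first conjunct certifies that the embedding
    takes values in [l^2]; the norm in the second is an extended real. *)
Theorem theorem7 (R : realType) (d : nat) (d_ge3 : (3 <= d)%N)
    (lambda : nat -> R) (phi : nat -> sphere R d.-1 -> R)
    (spectrum : cmds_spectrum (nvol R d.-1) lambda phi) :
  (forall u : sphere R d.-1,
     cmds_embedding lambda phi u \in Lfun (@counting _ R) 2%:E) /\
  (forall u v : sphere R d.-1,
     'N[@counting _ R]_2%:E [EFin \o (cmds_embedding lambda phi u \-
                                      cmds_embedding lambda phi v)%R] ^+ 2
     = (pi * sphere_dist u v)%:E)%E.
Proof.
split=> [u|u v].
  rewrite inE; apply/andP; split; rewrite inE//=.
  rewrite /finite_norm; have /cvg_ex[l al] := @cmds_embedding_sqr_cvg _ _ _ _ spectrum u.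
  by rewrite (Lnorm2_counting al) ltry.
rewrite (Lnorm2_counting (@cmds_embedding_cvg _ _ _ _ spectrum u v)).
by rewrite -EFin_expe sqr_sqrtr// mulr_ge0 ?pi_ge0 ?sphere_dist_ge0.
Qed.
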